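(* The globular extension $\widetilde\Theta$ is canonically $(\infty,0)$-contractible; that is, every $(\infty,0)$-admissible pair of morphisms of $\widetilde\Theta$ admits a unique lifting.
   Context: Globe category. $\mathbb{G}$ has objects $D_0,D_1,\dots$ and is generated by $\sigma_i,\tau_i:D_{i-1}\to D_i$ ($i\ge1$) subject to $\sigma_{i+1}\sigma_i=\tau_{i+1}\sigma_i$ and $\sigma_{i+1}\tau_i=\tau_{i+1}\tau_i$. For $i\ge j$, $\sigma^i_j=\sigma_i\cdots\sigma_{j+1}$ and $\tau^i_j=\tau_i\cdots\tau_{j+1}$, from $D_j$ to $D_i$. A globular set is a presheaf on $\mathbb{G}$; $\mathbb{G}$ is regarded as a full subcategory of globular sets by Yoneda. Strict $\infty$-groupoids. A strict $\infty$-category is a globular set $G$ (sets $G_i$ of $i$-arrows, source and target maps $s_i,t_i:G_i\to G_{i-1}$, iterated to $s^i_j,t^i_j:G_i\to G_j$) with compositions $u\ast^i_j v$ for $i$-arrows with $s^i_j(u)=t^i_j(v)$, $i>j\ge0$, and identities $k_i:G_i\to G_{i+1}$, satisfying the usual source/target, associativity, exchange, identity and functoriality-of-identities axioms. It is a strict $\infty$-groupoid if every $i$-arrow $u:x\to y$, $i\ge1$, has a $\ast^i_{i-1}$-inverse. Morphisms are the maps of globular sets preserving compositions and identities. $L$ denotes the left adjoint of the forgetful functor from strict $\infty$-groupoids to globular sets. Globular sums. A table of dimensions $T$ consists of integers $i_1,\dots,i_k\ge0$ and $i'_1,\dots,i'_{k-1}\ge0$ ($k\ge1$) with $i_l>i'_l<i_{l+1}$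 for $1\le l\le k-1$; its dimension is the largest integer in it. In a category $C$ under $\mathbb{G}$ (a category with a functor $\mathbb{G}\to C$; images of objects and morphisms keep the same symbols), the globular sum associated to $T$ is the colimit of the zigzag diagram $D_{i_1}\leftarrow D_{i'_1}\to D_{i_2}\leftarrow\cdots\leftarrow D_{i'_{k-1}}\to D_{i_k}$ whose maps are $\sigma^{i_l}_{i'_l}:D_{i'_l}\to D_{i_l}$ and $\tau^{i_{l+1}}_{i'_l}:D_{i'_l}\to D_{i_{l+1}}$. A globular extension is a category under $\mathbb{G}$ in which all globular sums exist. $G_T$ denotes the globular sum of $T$ in globular sets. $\widetilde\Theta$. Its objects are the tables of dimensions, and $\mathrm{Hom}_{\widetilde\Theta}(S,T)$ is the set of morphisms of strict $\infty$-groupoids $L(G_S)\to L(G_T)$. It is a category under $\mathbb{G}$ by sending $D_n$ to the table of width one $(n)$ and applying $L$ to morphisms; it is a globular extension, the object $T$ being the globular sum associated to $T$. Contractibility. Morphisms $f,g:D_n\to X$ in a globular extension are globularly parallel if $n=0$, or $n\ge1$, $f\sigma_n=g\sigma_n$ and $f\tau_n=g\tau_n$. A lifting of $(f,g)$ is $h:D_{n+1}\to X$ with $h\sigma_{n+1}=f$ and $h\tau_{n+1}=g$. A pair $(f,g):D_n\to S$ is $(\infty,0)$-admissible if $f,g$ are globularly parallel and $S$ is a globular sum of dimension (as a globular sum) at most $n+1$. *)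

(* Defs.v *)
From Stdlib Require Relation_Operators.
From mathcomp Require Import all_boot boolp.
From mathcomp Require Import generic_quotient.

Set Implicit Arguments.
Unset Strict Implicit.
Unset Printing Implicit Defensive.

Record category := Category {
  obj :> Type;
  hom : obj -> obj -> Type;
  idc : forall x, hom x x;
  compc : forall x y z, hom y z -> hom x y -> hom x z;
  compcA : forall x y z w (h : hom z w) (g : hom y z) (f : hom x y),
    compc h (compc g f) = compc (compc h g) f;
  compc1 : forall x y (f : hom x y), compc f (idc x) = f;
  comp1c : forall x y (f : hom x y), compc (idc y) f = f }.

Notation "g ∘ f" := (compc g f) (at level 40, left associativity).

Record functor (C D : category) := Functor {
  fobj :> C -> D;
  fmap : forall x y, hom x y -> hom (fobj x) (fobj y);
  fmap_id : forall x, fmap (idc x) = idc (fobj x);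
  fmap_comp : forall x y z (g : hom y z) (f : hom x y),
    fmap (g ∘ f) = fmap g ∘ fmap f }.

(* A left adjoint, given by a universal arrow from every object. *)
Record left_adjoint (C D : category) (U : functor D C) := LeftAdjoint {
  ladj :> C -> D;
  ladj_unit : forall x : C, hom x (U (ladj x));
  ladj_ext : forall (x : C) (y : D), hom x (U y) -> hom (ladj x) y;
  ladj_ext_unit : forall (x : C) (y : D) (f : hom x (U y)),
    fmap U (ladj_ext f) ∘ ladj_unit x = f;
  ladj_ext_uniq : forall (x : C) (y : D) (f : hom x (U y)) (g : hom (ladj x) y),
    fmap U g ∘ ladj_unit x = f -> g = ladj_ext f }.

Section LeftAdjointFunctor.
Variables (C D : category) (U : functor D C) (L : left_adjoint U).

Definition ladj_map (x y : C) (f : hom x y) : hom (L x) (L y) :=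
  ladj_ext L (ladj_unit L y ∘ f).

Lemma ladj_map_unit x y (f : hom x y) :
  fmap U (ladj_map f) ∘ ladj_unit L x = ladj_unit L y ∘ f.
Proof. exact: ladj_ext_unit. Qed.

Lemma ladj_hom_ext x (y : D) (f g : hom (L x) y) :
  fmap U f ∘ ladj_unit L x = fmap U g ∘ ladj_unit L x -> f = g.
Proof.
by move=> fg; rewrite (ladj_ext_uniq fg); apply/esym/ladj_ext_uniq.
Qed.

Lemma ladj_map_id x : ladj_map (idc x) = idc (L x).
Proof.
by apply: ladj_hom_ext; rewrite ladj_map_unit fmap_id comp1c compc1.
Qed.

Lemma ladj_map_comp x y z (g : hom y z) (f : hom x y) :
  ladj_map (g ∘ f) = ladj_map g ∘ ladj_map f.
Proof.
apply: ladj_hom_ext; rewrite ladj_map_unit fmap_comp -compcA ladj_map_unit.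
by rewrite !compcA ladj_map_unit.
Qed.

Definition ladj_functor : functor C D :=
  Functor ladj_map_id ladj_map_comp.

End LeftAdjointFunctor.

(* A functor from the globe category, which is presented by the generators     *)
(* [gsigma n, gtau n : D_n -> D_(n+1)] (written sigma_(n+1), tau_(n+1) on      *)
(* paper) and the relations below.                                             *)
Record category_under_globe := CategoryUnderGlobe {
  under_cat :> category;
  gD : nat -> under_cat;
  gsigma : forall n, hom (gD n) (gD n.+1);
  gtau : forall n, hom (gD n) (gD n.+1);
  gsigma_sigma : forall n, gsigma n.+1 ∘ gsigma n = gtau n.+1 ∘ gsigma n;
  gsigma_tau : forall n, gsigma n.+1 ∘ gtau n = gtau n.+1 ∘ gtau n }.

Arguments gD {_} _.
Arguments gsigma {_} _.
Arguments gtau {_} _.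

Section GlobularSums.
Variable C : category_under_globe.

Fixpoint gsigman d j : hom (gD j : C) (gD (d + j)) :=
  if d is d'.+1 then gsigma (d' + j) ∘ gsigman d' j else idc (gD j).

Fixpoint gtaun d j : hom (gD j : C) (gD (d + j)) :=
  if d is d'.+1 then gtau (d' + j) ∘ gtaun d' j else idc (gD j).

(* sigma^i_j and tau^i_j *)
Definition gsigma_iter i j (le_ji : j <= i) : hom (gD j : C) (gD i) :=
  ecast n (hom (gD j) (gD n)) (subnK le_ji) (gsigman (i - j) j).

Definition gtau_iter i j (le_ji : j <= i) : hom (gD j : C) (gD i) :=
  ecast n (hom (gD j) (gD n)) (subnK le_ji) (gtaun (i - j) j).

End GlobularSums.

(* The table i_1, ..., i_k; i'_1, ..., i'_(k-1) has [twidth = k - 1],          *)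
(* [tupper l = i_(l+1)] and [tlower l = i'_(l+1)]; for [l : 'I_twidth] the     *)
(* two neighbours of [tlower l] are at [lidx l] and [ridx l].                  *)
Definition lidx n (l : 'I_n) : 'I_n.+1 := widen_ord (leqnSn n) l.
Definition ridx n (l : 'I_n) : 'I_n.+1 := lift ord0 l.

Record table := Table {
  twidth : nat;
  tupper : 'I_twidth.+1 -> nat;
  tlower : 'I_twidth -> nat;
  tlower_ltl : forall l, tlower l < tupper (lidx l);
  tlower_ltr : forall l, tlower l < tupper (ridx l) }.

Definition tdim (T : table) : nat :=
  maxn (\max_(l < (twidth T).+1) tupper l) (\max_(l < twidth T) tlower l).

Lemma no_ord0 (P : 'I_0 -> Prop) l : P l.
Proof. by case: l. Qed.

(* The table of width one (n). *)
Definition tdisk (n : nat) : table :=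
  @Table 0 (fun=> n) (fun=> 0) (@no_ord0 _) (@no_ord0 _).

Section GlobularExtensions.
Variable C : category_under_globe.

(* Cocones under the zigzag of T; the leg at D_(i'_l) is redundant. *)
Record cocone (T : table) (X : C) := Cocone {
  leg : forall l : 'I_(twidth T).+1, hom (gD (tupper l)) X;
  leg_glue : forall l : 'I_(twidth T),
    leg (lidx l) ∘ gsigma_iter C (ltnW (tlower_ltl l))
    = leg (ridx l) ∘ gtau_iter C (ltnW (tlower_ltr l)) }.

Definition is_colimit (T : table) (X : C) (c : cocone T X) : Prop :=
  forall (Y : C) (c' : cocone T Y),
    exists! h : hom X Y, forall l, h ∘ leg c l = leg c' l.

Definition is_globular_sum (T : table) (X : C) : Prop :=
  exists c : cocone T X, is_colimit c.

End GlobularExtensions.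

Record globular_extension := GlobularExtension {
  gext :> category_under_globe;
  gext_sums : forall T : table, exists X : gext, is_globular_sum T X }.

Section Contractibility.
Variable C : globular_extension.

Definition globularly_parallel (n : nat) (X : C) :
    hom (gD n) X -> hom (gD n) X -> Prop :=
  match n with
  | 0 => fun _ _ => True
  | m.+1 => fun f g => f ∘ gsigma m = g ∘ gsigma m /\ f ∘ gtau m = g ∘ gtau m
  end.

Definition is_lifting (n : nat) (X : C) (f g : hom (gD n) X)
    (h : hom (gD n.+1) X) : Prop :=
  h ∘ gsigma n = f /\ h ∘ gtau n = g.

(* (oo, 0)-admissible pairs *)
Definition admissible (n : nat) (S : C) (f g : hom (gD n) S) : Prop :=
  globularly_parallel f g /\
  exists2 T : table, is_globular_sum T S & tdim T <= n.+1.

Definition canonically_contractible : Prop :=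
  forall (n : nat) (S : C) (f g : hom (gD n) S),
    admissible f g -> exists! h : hom (gD n.+1) S, is_lifting f g h.

End Contractibility.

Record globular_set := GlobularSet {
  cell :> nat -> Type;
  src : forall n, cell n.+1 -> cell n;
  tgt : forall n, cell n.+1 -> cell n;
  src_tgt : forall n (x : cell n.+2), src (tgt x) = src (src x);
  tgt_src : forall n (x : cell n.+2), tgt (src x) = tgt (tgt x) }.

Record globular_map (X Y : globular_set) := GlobularMap {
  gfun :> forall n, X n -> Y n;
  gfun_src : forall n (x : X n.+1), gfun (src x) = src (gfun x);
  gfun_tgt : forall n (x : X n.+1), gfun (tgt x) = tgt (gfun x) }.

Lemma globular_map_ext (X Y : globular_set) (f g : globular_map X Y) :
  (forall n (x : X n), f n x = g n x) -> f = g.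
Proof.
case: f g => [f fs ft] [g gs gt] /= fg.
have E : f = g by apply: functional_extensionality_dep => n; apply/funext/fg.
case: g / E gs gt {fg} => gs gt.
by rewrite (Prop_irrelevance fs gs) (Prop_irrelevance ft gt).
Qed.

Definition globular_id X : globular_map X X :=
  @GlobularMap X X (fun _ x => x) (fun _ _ => erefl) (fun _ _ => erefl).

Program Definition globular_comp X Y Z (g : globular_map Y Z)
    (f : globular_map X Y) : globular_map X Z :=
  @GlobularMap X Z (fun n x => g n (f n x)) _ _.
Next Obligation. by rewrite /= !gfun_src. Qed.
Next Obligation. by rewrite /= !gfun_tgt. Qed.

Program Definition gset_cat : category :=
  @Category globular_set globular_map globular_id globular_comp _ _ _.
Next Obligation. by apply: globular_map_ext. Qed.
Next Obligation. by apply: globular_map_ext. Qed.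
Next Obligation. by apply: globular_map_ext. Qed.

(* The presheaf represented by D_n: the only n-cell [None] is the identity of  *)
(* D_n and, for j < n, the two j-cells [Some false] and [Some true] are        *)
(* sigma^n_j and tau^n_j.                                                      *)
Definition disk_cell (n j : nat) : Type :=
  {c : option bool | if c is None then j == n else j < n}.

Lemma disk_cell_inj n j (c d : disk_cell n j) : sval c = sval d -> c = d.
Proof.
case: c d => [c cP] [d dP] /= cd; case: d / cd dP => dP.
by case: c cP dP => [b|] cP dP; rewrite (bool_irrelevance cP dP).
Qed.

Lemma disk_bdry_subproof n j (c : disk_cell n j.+1) : j < n.
Proof. by case: c => -[b|] /= => [/ltnW|/eqP <-]. Qed.

Definition disk_bdry n (b : bool) j (c : disk_cell n j.+1) : disk_cell n j :=
  exist _ (Some b) (disk_bdry_subproof c).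

Program Definition disk (n : nat) : globular_set :=
  @GlobularSet (disk_cell n) (@disk_bdry n false) (@disk_bdry n true) _ _.
Next Obligation. by apply: disk_cell_inj. Qed.
Next Obligation. by apply: disk_cell_inj. Qed.

Lemma disk_incl_subproof n b j (c : disk_cell n j) :
  if Some (odflt b (sval c)) is None then j == n.+1 else j < n.+1.
Proof. by case: c => -[c|] /= => [/ltnW|/eqP <-]. Qed.

(* Post-composition with sigma_(n+1) (b = false) or tau_(n+1) (b = true). *)
Program Definition disk_incl n b : globular_map (disk n) (disk n.+1) :=
  @GlobularMap (disk n) (disk n.+1)
    (fun j c => exist _ (Some (odflt b (sval c))) (disk_incl_subproof b c)) _ _.
Next Obligation. by apply: disk_cell_inj. Qed.
Next Obligation. by apply: disk_cell_inj. Qed.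

Program Definition gset : category_under_globe :=
  @CategoryUnderGlobe gset_cat disk
    (fun n => disk_incl n false) (fun n => disk_incl n true) _ _.
Next Obligation.
by apply: globular_map_ext => j x; apply: disk_cell_inj.
Qed.
Next Obligation.
by apply: globular_map_ext => j x; apply: disk_cell_inj.
Qed.

Lemma gfun_disk_bdry m n (f : globular_map (disk m) (disk n)) b j
    (x : disk m j.+1) :
  f j (disk_bdry b x) = disk_bdry b (f j.+1 x).
Proof. by case: b; [exact: (gfun_tgt f x)|exact: (gfun_src f x)]. Qed.

Section Quotient.
Variables (A : Type) (R : A -> A -> Prop).

Definition gen_equiv (a b : {classic A}) : bool :=
  `[< Relation_Operators.clos_refl_sym_trans A R a b >].

Lemma gen_equiv_refl : reflexive gen_equiv.
Proof. by move=> a; apply/asboolP; apply: Relation_Operators.rst_refl. Qed.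

Lemma gen_equiv_sym : symmetric gen_equiv.
Proof.
by move=> a b; apply/asboolP/asboolP; apply: Relation_Operators.rst_sym.
Qed.

Lemma gen_equiv_trans : transitive gen_equiv.
Proof.
move=> b a c /asboolP ab /asboolP bc; apply/asboolP.
exact: Relation_Operators.rst_trans ab bc.
Qed.

Canonical gen_equiv_rel :=
  EquivRel gen_equiv gen_equiv_refl gen_equiv_sym gen_equiv_trans.

(* The quotient of A by the equivalence relation generated by R. *)
Definition quotient : Type := {eq_quot gen_equiv_rel}%qT.

Definition qclass (a : A) : quotient := (\pi_{eq_quot gen_equiv_rel} a)%qT.

Definition qrepr (q : quotient) : A := repr (q : {eq_quot gen_equiv_rel}%qT).

Definition qlift (B : Type) (f : A -> B) (q : quotient) : B := f (qrepr q).

Lemma qreprK q : qclass (qrepr q) = q.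
Proof. exact: reprK. Qed.

Lemma qclass_eq a b : R a b -> qclass a = qclass b.
Proof. by move=> ab; apply/eqmodP/asboolP/Relation_Operators.rst_step. Qed.

Lemma qliftE (B : Type) (f : A -> B) (a : A) :
  (forall a b, R a b -> f a = f b) -> qlift f (qclass a) = f a.
Proof.
move=> fR; have: gen_equiv (qrepr (qclass a)) a by apply/eqmodP; exact: reprK.
rewrite /qlift => /asboolP; move: (qrepr _) => b; elim=> //.
by move=> x y z _ -> _ ->.
Qed.

End Quotient.

Section GsetGlobularSum.
Variable T : table.

Definition gsum_precell (n : nat) : Type :=
  {l : 'I_(twidth T).+1 & disk (tupper l) n}.

Definition gsum_incl n (l : 'I_(twidth T).+1) (x : disk (tupper l) n) :
  gsum_precell n := Tagged (fun l => disk (tupper l) n) x.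

Variant gsum_glue (n : nat) : gsum_precell n -> gsum_precell n -> Prop :=
  GsumGlue (l : 'I_(twidth T)) (x : disk (tlower l) n) :
    gsum_glue
      (gsum_incl ((gsigma_iter gset (ltnW (tlower_ltl l)) : globular_map _ _) n x))
      (gsum_incl ((gtau_iter gset (ltnW (tlower_ltr l)) : globular_map _ _) n x)).

Definition gsum_cell (n : nat) : Type := quotient (@gsum_glue n).

Definition gsum_bdry (b : bool) n : gsum_cell n.+1 -> gsum_cell n :=
  qlift (fun p : gsum_precell n.+1 =>
    qclass (@gsum_glue n) (gsum_incl (disk_bdry b (tagged p)))).

Lemma gsum_bdryE b n (l : 'I_(twidth T).+1) (x : disk (tupper l) n.+1) :
  gsum_bdry b (qclass (@gsum_glue n.+1) (gsum_incl x))
  = qclass (@gsum_glue n) (gsum_incl (disk_bdry b x)).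
Proof.
rewrite /gsum_bdry qliftE // => _ _ [{}l {}x] /=.
pose f := gsigma_iter gset (ltnW (tlower_ltl l)) : globular_map _ _.
pose g := gtau_iter gset (ltnW (tlower_ltr l)) : globular_map _ _.
rewrite -(gfun_disk_bdry f) -(gfun_disk_bdry g); apply: qclass_eq; exact: GsumGlue.
Qed.

Lemma gsum_ind n (P : gsum_cell n -> Prop) :
  (forall (l : 'I_(twidth T).+1) (x : disk (tupper l) n),
    P (qclass (@gsum_glue n) (gsum_incl x))) -> forall q, P q.
Proof. by move=> Pi q; rewrite -(qreprK q); case: (qrepr q). Qed.

(* G_T: the disjoint union of the disks D_(i_l), glued along the D_(i'_l). *)
Program Definition gsum : globular_set :=
  @GlobularSet gsum_cell (@gsum_bdry false) (@gsum_bdry true) _ _.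
Next Obligation.
elim/gsum_ind: x => l x; rewrite !gsum_bdryE.
by congr (qclass _ (gsum_incl _)); apply: disk_cell_inj.
Qed.
Next Obligation.
elim/gsum_ind: x => l x; rewrite !gsum_bdryE.
by congr (qclass _ (gsum_incl _)); apply: disk_cell_inj.
Qed.

Program Definition gsum_leg (l : 'I_(twidth T).+1) :
    globular_map (disk (tupper l)) gsum :=
  @GlobularMap (disk (tupper l)) gsum
    (fun n x => qclass (@gsum_glue n) (gsum_incl x)) _ _.
Next Obligation. by rewrite gsum_bdryE. Qed.
Next Obligation. by rewrite gsum_bdryE. Qed.

Program Definition gsum_cocone : @cocone gset T gsum :=
  @Cocone gset T gsum gsum_leg _.
Next Obligation.
by apply: globular_map_ext => n x; apply/qclass_eq/GsumGlue.
Qed.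

Section Desc.
Variables (Y : globular_set) (c : @cocone gset T Y).

Definition gsum_desc_fun n : gsum n -> Y n :=
  qlift (fun p : gsum_precell n => (leg c (tag p) : globular_map _ _) n (tagged p)).

Lemma gsum_desc_funE n (l : 'I_(twidth T).+1) (x : disk (tupper l) n) :
  gsum_desc_fun (gsum_leg l n x) = (leg c l : globular_map _ _) n x.
Proof.
rewrite /gsum_desc_fun qliftE // => _ _ [{}l {}x] /=.
exact: (congr1 (fun f : globular_map _ _ => f n x) (leg_glue c l)).
Qed.

Program Definition gsum_desc : globular_map gsum Y :=
  @GlobularMap gsum Y gsum_desc_fun _ _.
Next Obligation.
elim/gsum_ind: x => l x.
have := gsum_desc_funE x; rewrite /= => ->; rewrite gsum_bdryE.
have := gsum_desc_funE (disk_bdry false x); rewrite /= => ->.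
exact: (gfun_src (leg c l : globular_map _ _)).
Qed.
Next Obligation.
elim/gsum_ind: x => l x.
have := gsum_desc_funE x; rewrite /= => ->; rewrite gsum_bdryE.
have := gsum_desc_funE (disk_bdry true x); rewrite /= => ->.
exact: (gfun_tgt (leg c l : globular_map _ _)).
Qed.

End Desc.

Lemma gsum_hom_ext (Y : gset) (f g : hom (gsum : gset) Y) :
  (forall l, f ∘ leg gsum_cocone l = g ∘ leg gsum_cocone l) -> f = g.
Proof.
move=> fg; apply: globular_map_ext => n; elim/gsum_ind => l x.
exact: (congr1 (fun h : globular_map _ _ => h n x) (fg l)).
Qed.

Lemma gsum_descE (Y : gset) (c : cocone T Y) l :
  (gsum_desc c : hom (gsum : gset) Y) ∘ leg gsum_cocone l = leg c l.
Proof. by apply: globular_map_ext => n x; apply: gsum_desc_funE. Qed.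

Lemma gsum_colimit : is_colimit gsum_cocone.
Proof.
move=> Y c; exists (gsum_desc c); split=> [l|h hE]; first exact: gsum_descE.
by apply: gsum_hom_ext => l; rewrite gsum_descE hE.
Qed.

End GsetGlobularSum.

(* G_(n) is D_n. *)
Definition gsum_tdisk_leg n : hom (disk n : gset) (gsum (tdisk n)) :=
  leg (gsum_cocone (tdisk n)) ord0.

Definition tdisk_cocone n (Y : gset) (f : hom (disk n : gset) Y) :
    cocone (tdisk n) Y :=
  @Cocone gset (tdisk n) Y (fun=> f) (@no_ord0 _).

Definition gsum_tdisk_desc n (Y : gset) (f : hom (disk n : gset) Y) :
    hom (gsum (tdisk n) : gset) Y :=
  gsum_desc (tdisk_cocone f).

Lemma gsum_tdisk_descE n (Y : gset) (f : hom (disk n : gset) Y) :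
  gsum_tdisk_desc f ∘ gsum_tdisk_leg n = f.
Proof. exact: (gsum_descE (tdisk_cocone f) ord0). Qed.

(* The morphism G_(m) -> G_(n) corresponding to D_m -> D_n. *)
Definition gsum_tdisk_map m n (f : hom (disk m : gset) (disk n)) :
    hom (gsum (tdisk m) : gset) (gsum (tdisk n)) :=
  gsum_tdisk_desc (gsum_tdisk_leg n ∘ f).

Lemma gsum_tdisk_mapE m n (f : hom (disk m : gset) (disk n)) :
  gsum_tdisk_map f ∘ gsum_tdisk_leg m = gsum_tdisk_leg n ∘ f.
Proof. exact: gsum_tdisk_descE. Qed.

Lemma gsum_tdisk_ext n (Y : gset) (f g : hom (gsum (tdisk n) : gset) Y) :
  f ∘ gsum_tdisk_leg n = g ∘ gsum_tdisk_leg n -> f = g.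
Proof. by move=> fg; apply: gsum_hom_ext => l; rewrite ord1. Qed.

Lemma gsum_tdisk_map_id n :
  gsum_tdisk_map (idc (disk n : gset)) = idc (gsum (tdisk n) : gset).
Proof. by apply: gsum_tdisk_ext; rewrite gsum_tdisk_mapE compc1 comp1c. Qed.

Lemma gsum_tdisk_map_comp m n p (g : hom (disk n : gset) (disk p))
    (f : hom (disk m : gset) (disk n)) :
  gsum_tdisk_map (g ∘ f) = gsum_tdisk_map g ∘ gsum_tdisk_map f.
Proof.
apply: gsum_tdisk_ext.
by rewrite -compcA !gsum_tdisk_mapE !compcA gsum_tdisk_mapE.
Qed.

Section IteratedBoundaries.
Variable X : globular_set.

Fixpoint srcn d j : X (d + j) -> X j :=
  if d is d'.+1 then fun x => srcn (src x) else fun x => x.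

Fixpoint tgtn d j : X (d + j) -> X j :=
  if d is d'.+1 then fun x => tgtn (tgt x) else fun x => x.

(* s^i_j and t^i_j *)
Definition src_iter i j (le_ji : j <= i) (x : X i) : X j :=
  srcn (ecast n (X n) (esym (subnK le_ji)) x).

Definition tgt_iter i j (le_ji : j <= i) (x : X i) : X j :=
  tgtn (ecast n (X n) (esym (subnK le_ji)) x).

Variable idn : forall n, X n -> X n.+1.

Fixpoint iidn d j (x : X j) : X (d + j) :=
  if d is d'.+1 then idn (iidn d' x) else x.

Definition id_iter i j (le_ji : j <= i) (x : X j) : X i :=
  ecast n (X n) (subnK le_ji) (iidn (i - j) x).

End IteratedBoundaries.

(* In the axioms, the composability hypotheses e, e', ... of all the           *)
(* composites involved are universally quantified; those that bear on a        *)
(* composite of cells, or on its source and target, always follow from the     *)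
(* others and the source and target axioms.                                    *)
Record infty_category := InftyCategory {
  icells :> globular_set;
  (* icomp _ u v _ is u *^i_j v *)
  icomp : forall i j (ltji : j < i) (u v : icells i),
    src_iter (ltnW ltji) u = tgt_iter (ltnW ltji) v -> icells i;
  iid : forall i, icells i -> icells i.+1;
  icomp_src_top : forall i (lti : i < i.+1) (u v : icells i.+1) e,
    src (@icomp i.+1 i lti u v e) = src v;
  icomp_tgt_top : forall i (lti : i < i.+1) (u v : icells i.+1) e,
    tgt (@icomp i.+1 i lti u v e) = tgt u;
  icomp_src : forall i j (ltji : j < i) (ltjSi : j < i.+1) (u v : icells i.+1)
    e e', src (@icomp i.+1 j ltjSi u v e) = @icomp i j ltji (src u) (src v) e';
  icomp_tgt : forall i j (ltji : j < i) (ltjSi : j < i.+1) (u v : icells i.+1)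
    e e', tgt (@icomp i.+1 j ltjSi u v e) = @icomp i j ltji (tgt u) (tgt v) e';
  iid_src : forall i (u : icells i), src (iid u) = u;
  iid_tgt : forall i (u : icells i), tgt (iid u) = u;
  icompA : forall i j (ltji : j < i) (u v w : icells i) euv evw e e',
    @icomp i j ltji (@icomp i j ltji u v euv) w e
    = @icomp i j ltji u (@icomp i j ltji v w evw) e';
  icomp_exchange : forall i j k (ltji : j < i) (ltki : k < i), k < j ->
    forall (u u' v v' : icells i) e1 e2 e3 e4 e5 e6,
    @icomp i k ltki (@icomp i j ltji u u' e1) (@icomp i j ltji v v' e2) e3
    = @icomp i j ltji (@icomp i k ltki u v e4) (@icomp i k ltki u' v' e5) e6;
  icomp1l : forall i j (ltji : j < i) (u : icells i) e,
    @icomp i j ltji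
      (id_iter iid (ltnW ltji) (tgt_iter (ltnW ltji) u)) u e = u;
  icomp1r : forall i j (ltji : j < i) (u : icells i) e,
    @icomp i j ltji u
      (id_iter iid (ltnW ltji) (src_iter (ltnW ltji) u)) e = u;
  iid_comp : forall i j (ltji : j < i) (ltjSi : j < i.+1) (u v : icells i) e e',
    iid (@icomp i j ltji u v e) = @icomp i.+1 j ltjSi (iid u) (iid v) e' }.

Arguments icomp {_ _ _} ltji u v _.

(* v is an inverse of u for *^(i+1)_i. *)
Definition is_inverse (X : infty_category) i (u v : X i.+1) : Prop :=
  (exists e, icomp (ltnSn i) v u e = iid (src u)) /\
  (exists e, icomp (ltnSn i) u v e = iid (tgt u)).

Record infty_groupoid := InftyGroupoid {
  igpd :> infty_category;
  igpd_inv : forall i (u : igpd i.+1), exists v, is_inverse u v }.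

Record infty_functor (X Y : infty_category) := InftyFunctor {
  ifun :> globular_map X Y;
  ifun_comp : forall i j (ltji : j < i) (u v : X i) e e',
    ifun i (icomp ltji u v e)
    = icomp ltji (ifun i u) (ifun i v) e';
  ifun_id : forall i (u : X i), ifun i.+1 (iid u) = iid (ifun i u) }.

Arguments ifun_comp {_ _} _ {_ _ _ _ _} _ _.

Lemma infty_functor_ext (X Y : infty_category) (f g : infty_functor X Y) :
  ifun f = ifun g -> f = g.
Proof.
case: f g => [f fc fi] [g gc gi] /= fg.
case: g / fg gc gi => gc gi.
by rewrite (Prop_irrelevance fc gc) (Prop_irrelevance fi gi).
Qed.

Section MapIterated.
Variables X Y : globular_set.

Lemma gfun_srcn (f : globular_map X Y) d j (x : X (d + j)) :
  f j (srcn x) = srcn (f _ x).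
Proof. by elim: d x => [//|d IH] x /=; rewrite IH gfun_src. Qed.

Lemma gfun_tgtn (f : globular_map X Y) d j (x : X (d + j)) :
  f j (tgtn x) = tgtn (f _ x).
Proof. by elim: d x => [//|d IH] x /=; rewrite IH gfun_tgt. Qed.

Lemma gfun_ecast (f : forall n, X n -> Y n) m n (e : m = n) (x : X m) :
  f n (ecast k (X k) e x) = ecast k (Y k) e (f m x).
Proof. by case: n / e. Qed.

Lemma gfun_src_iter (f : globular_map X Y) i j (le_ji : j <= i) (x : X i) :
  f j (src_iter le_ji x) = src_iter le_ji (f i x).
Proof. by rewrite /src_iter gfun_srcn gfun_ecast. Qed.

Lemma gfun_tgt_iter (f : globular_map X Y) i j (le_ji : j <= i) (x : X i) :
  f j (tgt_iter le_ji x) = tgt_iter le_ji (f i x).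
Proof. by rewrite /tgt_iter gfun_tgtn gfun_ecast. Qed.

Lemma gfun_id_iter (f : globular_map X Y) (k : forall n, X n -> X n.+1)
    (k' : forall n, Y n -> Y n.+1) :
  (forall n (x : X n), f n.+1 (k n x) = k' n (f n x)) ->
  forall i j (le_ji : j <= i) (x : X j),
    f i (id_iter k le_ji x) = id_iter k' le_ji (f j x).
Proof.
move=> fk i j le_ji x; rewrite /id_iter gfun_ecast; congr (ecast _ _ _ _).
by elim: (i - j) => //= d IH; rewrite fk IH.
Qed.

Lemma gfun_composable (f : globular_map X Y) i j (le_ji : j <= i) (u v : X i) :
  src_iter le_ji u = tgt_iter le_ji v ->
  src_iter le_ji (f i u) = tgt_iter le_ji (f i v).
Proof. by rewrite -gfun_src_iter -gfun_tgt_iter => ->. Qed.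

End MapIterated.

Program Definition infty_functor_id X : infty_functor X X :=
  @InftyFunctor X X (globular_id X) _ _.
Next Obligation. by congr (icomp _ _ _ _); apply: Prop_irrelevance. Qed.

Program Definition infty_functor_comp X Y Z (g : infty_functor Y Z)
    (f : infty_functor X Y) : infty_functor X Z :=
  @InftyFunctor X Z (globular_comp g f) _ _.
Next Obligation.
rewrite (ifun_comp f e (gfun_composable f e)).
exact: (ifun_comp g (gfun_composable f e) e').
Qed.
Next Obligation. by rewrite !ifun_id. Qed.

Program Definition infty_groupoid_cat : category :=
  @Category infty_groupoid infty_functor
    infty_functor_id infty_functor_comp _ _ _.
Next Obligation. by apply/infty_functor_ext/globular_map_ext. Qed.
Next Obligation. by apply/infty_functor_ext/globular_map_ext. Qed.
Next Obligation. by apply/infty_functor_ext/globular_map_ext. Qed.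

Program Definition forgetful : functor infty_groupoid_cat gset :=
  @Functor infty_groupoid_cat gset_cat
    (fun X : infty_groupoid => X : globular_set)
    (fun X Y (f : infty_functor X Y) => f : globular_map X Y) _ _.

Section Inverses.
Variable X : infty_category.

Lemma src_iter1 i (le_i : i <= i.+1) (x : X i.+1) : src_iter le_i x = src x.
Proof.
rewrite /src_iter; move: (subnK le_i) => e.
have d1 : i.+1 - i = 1 by rewrite subSnn.
by move: (i.+1 - i) d1 e => d -> e; rewrite (eq_irrelevance e erefl).
Qed.

Lemma tgt_iter1 i (le_i : i <= i.+1) (x : X i.+1) : tgt_iter le_i x = tgt x.
Proof.
rewrite /tgt_iter; move: (subnK le_i) => e.
have d1 : i.+1 - i = 1 by rewrite subSnn.
by move: (i.+1 - i) d1 e => d -> e; rewrite (eq_irrelevance e erefl).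
Qed.

Lemma id_iter1 i (le_i : i <= i.+1) (x : X i) :
  id_iter (@iid X) le_i x = iid x.
Proof.
rewrite /id_iter; move: (subnK le_i) => e.
have d1 : i.+1 - i = 1 by rewrite subSnn.
by move: (i.+1 - i) d1 e => d -> e; rewrite (eq_irrelevance e erefl).
Qed.

Lemma icomp_congr i j (h : j < i) (u u' v v' : X i) e e' :
  u = u' -> v = v' -> icomp h u v e = icomp h u' v' e'.
Proof.
by move=> uu vv; move: e; rewrite uu vv => e; congr icomp; apply: Prop_irrelevance.
Qed.

Lemma inverse_uniq i (u v v' : X i.+1) :
  is_inverse u v -> is_inverse u v' -> v = v'.
Proof.
move=> [[e1 vu] _] [[f1 _] [f2 uv']].
have sv : src v = tgt u by have := e1; rewrite src_iter1 tgt_iter1.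
have tv' : src u = tgt v' by have := f2; rewrite src_iter1 tgt_iter1.
have c1 : src_iter (ltnW (ltnSn i)) (iid (src u)) = tgt_iter (ltnW (ltnSn i)) v'.
  by rewrite src_iter1 tgt_iter1 iid_src.
have c2 : src_iter (ltnW (ltnSn i)) v = tgt_iter (ltnW (ltnSn i)) (iid (tgt u)).
  by rewrite src_iter1 tgt_iter1 iid_tgt.
have c3 : src_iter (ltnW (ltnSn i)) (icomp (ltnSn i) v u e1)
    = tgt_iter (ltnW (ltnSn i)) v' by rewrite vu.
have c4 : src_iter (ltnW (ltnSn i)) v
    = tgt_iter (ltnW (ltnSn i)) (icomp (ltnSn i) u v' f2) by rewrite uv'.
have lhs : icomp (ltnSn i) v (icomp (ltnSn i) u v' f2) c4 = v.
  have c5 : src_iter (ltnW (ltnSn i)) v = tgt_iter (ltnW (ltnSn i))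
      (id_iter (@iid X) (ltnW (ltnSn i)) (src_iter (ltnW (ltnSn i)) v)).
    by rewrite id_iter1 src_iter1 tgt_iter1 iid_tgt.
  rewrite -[RHS](icomp1r c5); apply: icomp_congr => //.
  by rewrite id_iter1 src_iter1 sv.
have rhs : icomp (ltnSn i) (icomp (ltnSn i) v u e1) v' c3 = v'.
  have c5 : src_iter (ltnW (ltnSn i))
      (id_iter (@iid X) (ltnW (ltnSn i)) (tgt_iter (ltnW (ltnSn i)) v'))
      = tgt_iter (ltnW (ltnSn i)) v'.
    by rewrite id_iter1 src_iter1 !tgt_iter1 iid_src.
  rewrite -[RHS](icomp1l c5); apply: icomp_congr => //.
  by rewrite id_iter1 tgt_iter1 -tv'.
by rewrite -lhs -[RHS]rhs; apply/esym/icompA.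
Qed.

End Inverses.

Lemma is_inverse_map (X Y : infty_category) (f : infty_functor X Y) i
    (u v : X i.+1) :
  is_inverse u v -> is_inverse (f i.+1 u) (f i.+1 v).
Proof.
move=> [[e1 vu] [e2 uv]]; split.
  exists (gfun_composable f e1).
  by rewrite -(ifun_comp f e1) vu ifun_id gfun_src.
exists (gfun_composable f e2).
by rewrite -(ifun_comp f e2) uv ifun_id gfun_tgt.
Qed.

(* The free strict infinity-groupoid on G: formal expressions that denote a    *)
(* cell in every strict infinity-groupoid under G, two of them being           *)
(* identified if they denote the same cell in all of these.                    *)
Section FreeGroupoid.
Variable G : globular_set.

Inductive fterm : nat -> Type :=
| TGen n : G n -> fterm n
| TSrc n : fterm n.+1 -> fterm n
| TTgt n : fterm n.+1 -> fterm n
| TComp n (j : nat) : fterm n -> fterm n -> fterm n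
| TId n : fterm n -> fterm n.+1
| TInv n : fterm n.+1 -> fterm n.+1.

Section Denotation.
Variables (H : infty_groupoid) (f : globular_map G H).

Fixpoint denotes n (u : fterm n) : H n -> Prop :=
  match u in fterm n return H n -> Prop with
  | TGen n x => fun a => a = f n x
  | TSrc n u => fun a => exists2 b, denotes u b & a = src b
  | TTgt n u => fun a => exists2 b, denotes u b & a = tgt b
  | TComp n j u v => fun a => exists b c (ltjn : j < n) e,
      [/\ denotes u b, denotes v c & a = icomp ltjn b c e]
  | TId n u => fun a => exists2 b, denotes u b & a = iid b
  | TInv n u => fun a => exists2 b, denotes u b & is_inverse b a
  end.

Lemma denotes_fun n (u : fterm n) a b : denotes u a -> denotes u b -> a = b.
Proof.
elim: u a b => {n} /=.
- by move=> n x a b -> ->.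
- by move=> n u IH a b [a' ua ->] [b' ub ->]; rewrite (IH _ _ ua ub).
- by move=> n u IH a b [a' ua ->] [b' ub ->]; rewrite (IH _ _ ua ub).
- move=> n j u IHu v IHv a b [a1 [a2 [lta [ea [ua1 va2 ->]]]]].
  move=> [b1 [b2 [ltb [eb [ub1 vb2 ->]]]]].
  rewrite (bool_irrelevance ltb lta) in eb *.
  by apply: icomp_congr; [apply: IHu|apply: IHv].
- by move=> n u IH a b [a' ua ->] [b' ub ->]; rewrite (IH _ _ ua ub).
- move=> n u IH a b [a' ua ia] [b' ub ib].
  by rewrite (IH _ _ ub ua) in ib; apply: inverse_uniq ia ib.
Qed.

End Denotation.

Definition valid n (u : fterm n) : Prop :=
  forall (H : infty_groupoid) (f : globular_map G H), exists a, denotes f u a.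

Definition fequiv n (u v : {u : fterm n | valid u}) : Prop :=
  forall (H : infty_groupoid) (f : globular_map G H) a,
    denotes f (sval u) a -> denotes f (sval v) a.

Definition fcell n : Type := quotient (@fequiv n).

Definition fmk n (u : fterm n) (uP : valid u) : fcell n :=
  qclass (@fequiv n) (exist _ u uP).

Definition frepr n (q : fcell n) : fterm n := sval (qrepr q).

Lemma frepr_valid n (q : fcell n) : valid (frepr q).
Proof. exact: svalP (qrepr q). Qed.

Definition feval (H : infty_groupoid) (f : globular_map G H) n (q : fcell n) :
  H n := sval (cid (frepr_valid q f)).

Lemma feval_repr (H : infty_groupoid) (f : globular_map G H) n (q : fcell n) :
  denotes f (frepr q) (feval f q).
Proof. exact: svalP (cid (frepr_valid q f)). Qed.

Lemma fmk_repr n (q : fcell n) : fmk (frepr_valid q) = q.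
Proof.
rewrite -[RHS]qreprK /fmk; congr qclass; move: (frepr_valid q).
rewrite /frepr; case: (qrepr q) => u uP /= uP'; congr exist.
exact: Prop_irrelevance.
Qed.

Lemma feval_mk (H : infty_groupoid) (f : globular_map G H) n (u : fterm n) (uP : valid u) a :
  denotes f u a -> feval f (fmk uP) = a.
Proof.
move=> ua; pose ev (w : {u : fterm n | valid u}) := sval (cid (svalP w H f)).
have evP w : denotes f (sval w) (ev w) by exact: svalP (cid (svalP w H f)).
have : qlift ev (fmk uP) = ev (exist _ u uP).
  rewrite /fmk qliftE // => v w vw.
  by apply: (denotes_fun (vw _ _ _ (evP v)) (evP w)).
rewrite /qlift => E; apply: (denotes_fun (feval_repr _ _)).
suff -> : a = ev (qrepr (fmk uP)) by apply: evP.
by rewrite E; apply: denotes_fun ua (evP (exist _ u uP)).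
Qed.

Lemma feval_inj n (q r : fcell n) :
  (forall (H : infty_groupoid) (f : globular_map G H), feval f q = feval f r) ->
  q = r.
Proof.
move=> qr; rewrite -(qreprK q) -(qreprK r); apply: qclass_eq => H f a qa.
rewrite (denotes_fun qa (feval_repr f q)) qr; exact: feval_repr.
Qed.

Lemma fsrc_valid n (u : fterm n.+1) : valid u -> valid (TSrc u).
Proof. by move=> uP H f; have [a ua] := uP H f; exists (src a); exists a. Qed.

Lemma ftgt_valid n (u : fterm n.+1) : valid u -> valid (TTgt u).
Proof. by move=> uP H f; have [a ua] := uP H f; exists (tgt a); exists a. Qed.

Lemma fid_valid n (u : fterm n) : valid u -> valid (TId u).
Proof. by move=> uP H f; have [a ua] := uP H f; exists (iid a); exists a. Qed.

Lemma finv_valid n (u : fterm n.+1) : valid u -> valid (TInv u).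
Proof.
move=> uP H f; have [a ua] := uP H f; have [b ab] := igpd_inv a.
by exists b; exists a.
Qed.

Definition fsrc n (q : fcell n.+1) : fcell n := fmk (fsrc_valid (frepr_valid q)).
Definition ftgt n (q : fcell n.+1) : fcell n := fmk (ftgt_valid (frepr_valid q)).
Definition fid n (q : fcell n) : fcell n.+1 := fmk (fid_valid (frepr_valid q)).
Definition finv n (q : fcell n.+1) : fcell n.+1 :=
  fmk (finv_valid (frepr_valid q)).

Section EvalOps.
Variables (H : infty_groupoid) (f : globular_map G H).

Lemma feval_src n (q : fcell n.+1) : feval f (fsrc q) = src (feval f q).
Proof. by apply: feval_mk; exists (feval f q) => //; apply: feval_repr. Qed.

Lemma feval_tgt n (q : fcell n.+1) : feval f (ftgt q) = tgt (feval f q).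
Proof. by apply: feval_mk; exists (feval f q) => //; apply: feval_repr. Qed.

Lemma feval_id n (q : fcell n) : feval f (fid q) = iid (feval f q).
Proof. by apply: feval_mk; exists (feval f q) => //; apply: feval_repr. Qed.

Lemma feval_inv n (q : fcell n.+1) : is_inverse (feval f q) (feval f (finv q)).
Proof.
have [b qb] := igpd_inv (feval f q).
suff -> : feval f (finv q) = b by [].
by apply: feval_mk; exists (feval f q) => //; apply: feval_repr.
Qed.

End EvalOps.

Program Definition free_gset : globular_set :=
  @GlobularSet fcell fsrc ftgt _ _.
Next Obligation.
by apply: feval_inj => H f; rewrite !(feval_src, feval_tgt) src_tgt.
Qed.
Next Obligation.
by apply: feval_inj => H f; rewrite !(feval_src, feval_tgt) tgt_src.
Qed.

Definition feval_map (H : infty_groupoid) (f : globular_map G H) :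
    globular_map free_gset H :=
  @GlobularMap free_gset H (feval f) (feval_src f) (feval_tgt f).

Lemma fcomp_valid i j (ltji : j < i) (q r : free_gset i) :
  src_iter (ltnW ltji) q = tgt_iter (ltnW ltji) r ->
  valid (TComp j (frepr q) (frepr r)).
Proof.
move=> e H f; exists (icomp ltji _ _ (gfun_composable (feval_map f) e)).
exists (feval f q), (feval f r), ltji, (gfun_composable (feval_map f) e).
by split=> //; apply: feval_repr.
Qed.

Definition fcomp i j (ltji : j < i) (q r : free_gset i)
    (e : src_iter (ltnW ltji) q = tgt_iter (ltnW ltji) r) : free_gset i :=
  fmk (fcomp_valid e).

Lemma feval_comp (H : infty_groupoid) (f : globular_map G H) i j (ltji : j < i)
    (q r : free_gset i) (e : src_iter (ltnW ltji) q = tgt_iter (ltnW ltji) r) e' :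
  feval f (fcomp e) = icomp ltji (feval f q) (feval f r) e'.
Proof.
apply: feval_mk; exists (feval f q), (feval f r), ltji, e'.
by split=> //; apply: feval_repr.
Qed.

Lemma feval_composable (H : infty_groupoid) (f : globular_map G H) i j
    (le_ji : j <= i) (q r : free_gset i) :
  src_iter le_ji q = tgt_iter le_ji r ->
  src_iter le_ji (feval f q) = tgt_iter le_ji (feval f r).
Proof. exact: (gfun_composable (feval_map f)). Qed.

Lemma feval_src_iter (H : infty_groupoid) (f : globular_map G H) i j
    (le_ji : j <= i) (q : free_gset i) :
  feval f (src_iter le_ji q) = src_iter le_ji (feval f q).
Proof. exact: (gfun_src_iter (feval_map f)). Qed.

Lemma feval_tgt_iter (H : infty_groupoid) (f : globular_map G H) i j
    (le_ji : j <= i) (q : free_gset i) :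
  feval f (tgt_iter le_ji q) = tgt_iter le_ji (feval f q).
Proof. exact: (gfun_tgt_iter (feval_map f)). Qed.

Lemma feval_id_iter (H : infty_groupoid) (f : globular_map G H) i j
    (le_ji : j <= i) (q : free_gset j) :
  feval f (id_iter (X := free_gset) fid le_ji q)
  = id_iter (@iid H) le_ji (feval f q).
Proof.
exact: (@gfun_id_iter _ _ (feval_map f) fid (@iid H) (feval_id f)).
Qed.

Program Definition free_cat : infty_category :=
  @InftyCategory free_gset fcomp fid _ _ _ _ _ _ _ _ _ _ _.
Next Obligation.
apply: feval_inj => H f; rewrite feval_src (feval_comp _ (feval_composable f e)).
by rewrite icomp_src_top; exact: esym (feval_src f v).
Qed.
Next Obligation.
apply: feval_inj => H f; rewrite feval_tgt (feval_comp _ (feval_composable f e)).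
by rewrite icomp_tgt_top; exact: esym (feval_tgt f u).
Qed.
Next Obligation.
apply: feval_inj => H f; rewrite feval_src (feval_comp _ (feval_composable f e)).
rewrite (feval_comp _ (feval_composable f e')).
have E := feval_composable f e'; rewrite !feval_src in E.
by rewrite (icomp_src _ E); apply: icomp_congr; rewrite feval_src.
Qed.
Next Obligation.
apply: feval_inj => H f; rewrite feval_tgt (feval_comp _ (feval_composable f e)).
rewrite (feval_comp _ (feval_composable f e')).
have E := feval_composable f e'; rewrite !feval_tgt in E.
by rewrite (icomp_tgt _ E); apply: icomp_congr; rewrite feval_tgt.
Qed.
Next Obligation.
by apply: feval_inj => H f; rewrite feval_src feval_id iid_src.
Qed.
Next Obligation.
by apply: feval_inj => H f; rewrite feval_tgt feval_id iid_tgt.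
Qed.
Next Obligation.
apply: feval_inj => H f.
pose E1 := feval_composable f euv; pose E2 := feval_composable f evw.
have E3 := feval_composable f e; rewrite (feval_comp _ E1) in E3.
have E4 := feval_composable f e'; rewrite (feval_comp _ E2) in E4.
rewrite !(feval_comp _ (feval_composable f e), feval_comp _ (feval_composable f e')).
transitivity (icomp ltji _ _ E3).
  by apply: icomp_congr => //; apply: feval_comp.
rewrite (icompA _ E4).
by apply: icomp_congr => //; apply/esym/feval_comp.
Qed.
Next Obligation.
apply: feval_inj => K f.
pose E1 := feval_composable f e1; pose E2 := feval_composable f e2.
pose E4 := feval_composable f e4; pose E5 := feval_composable f e5.
have E3 := feval_composable f e3.
rewrite (feval_comp _ E1) (feval_comp _ E2) in E3.
have E6 := feval_composable f e6.
rewrite (feval_comp _ E4) (feval_comp _ E5) in E6.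
rewrite (feval_comp _ (feval_composable f e3)).
rewrite (feval_comp _ (feval_composable f e6)).
transitivity (icomp ltki _ _ E3).
  by apply: icomp_congr; apply: feval_comp.
rewrite (icomp_exchange _ _ E6) //.
by apply: icomp_congr; apply/esym/feval_comp.
Qed.
Next Obligation.
apply: feval_inj => H f; rewrite (feval_comp _ (feval_composable f e)).
have E := feval_composable f e.
rewrite feval_id_iter feval_tgt_iter in E.
rewrite -[RHS](icomp1l E); apply: icomp_congr => //.
by rewrite feval_id_iter feval_tgt_iter.
Qed.
Next Obligation.
apply: feval_inj => H f; rewrite (feval_comp _ (feval_composable f e)).
have E := feval_composable f e.
rewrite feval_id_iter feval_src_iter in E.
rewrite -[RHS](icomp1r E); apply: icomp_congr => //.
by rewrite feval_id_iter feval_src_iter.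
Qed.
Next Obligation.
apply: feval_inj => H f; rewrite feval_id (feval_comp _ (feval_composable f e)).
rewrite (feval_comp _ (feval_composable f e')).
have E := feval_composable f e'; rewrite !feval_id in E.
by rewrite (iid_comp _ E); apply: icomp_congr; rewrite feval_id.
Qed.

Lemma free_inverse i (q r : free_cat i.+1) :
  (forall (H : infty_groupoid) (f : globular_map G H),
     is_inverse (feval f q) (feval f r)) -> is_inverse q r.
Proof.
move=> qr.
have e1 : src_iter (ltnW (ltnSn i)) r = tgt_iter (ltnW (ltnSn i)) q.
  apply: feval_inj => H f; have [[e _] _] := qr H f.
  by rewrite feval_src_iter feval_tgt_iter.
have e2 : src_iter (ltnW (ltnSn i)) q = tgt_iter (ltnW (ltnSn i)) r.
  apply: feval_inj => H f; have [_ [e _]] := qr H f.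
  by rewrite feval_src_iter feval_tgt_iter.
split; [exists e1|exists e2]; apply: feval_inj => H f.
  have [[e E] _] := qr H f.
  by rewrite feval_id feval_src -E; apply: feval_comp.
have [_ [e E]] := qr H f.
by rewrite feval_id feval_tgt -E; apply: feval_comp.
Qed.

Program Definition free_groupoid : infty_groupoid := @InftyGroupoid free_cat _.
Next Obligation.
by exists (finv u); apply: free_inverse => H f; apply: feval_inv.
Qed.

Definition free_ext (H : infty_groupoid) (f : globular_map G H) :
    infty_functor free_groupoid H :=
  @InftyFunctor free_groupoid H (feval_map f)
    (fun i j ltji u v e e' => feval_comp e e') (fun i u => feval_id f u).

Lemma fgen_valid n (x : G n) : valid (TGen x).
Proof. by move=> H f; exists (f n x). Qed.

Program Definition free_unit : globular_map G free_groupoid :=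
  @GlobularMap G free_groupoid (fun n x => fmk (fgen_valid x)) _ _.
Next Obligation.
apply: feval_inj => H f; rewrite feval_src.
rewrite (feval_mk (f := f) _ (a := f n (src x))) // gfun_src.
by congr src; apply/esym/feval_mk.
Qed.
Next Obligation.
apply: feval_inj => H f; rewrite feval_tgt.
rewrite (feval_mk (f := f) _ (a := f n (tgt x))) // gfun_tgt.
by congr tgt; apply/esym/feval_mk.
Qed.

Lemma free_ext_unit (H : infty_groupoid) (f : globular_map G H) :
  globular_comp (free_ext f) free_unit = f.
Proof. by apply: globular_map_ext => n x; apply: feval_mk. Qed.

Lemma free_denotes (H : infty_groupoid) (f : globular_map G H)
    (g : infty_functor free_groupoid H) :
  globular_comp g free_unit = f ->
  forall n (u : fterm n) (uP : valid u), denotes f u (g n (fmk uP)).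
Proof.
move=> gf n u; elim: u => {n} /=.
- move=> n x uP; rewrite -gf /=; congr (g n _).
  by apply: feval_inj => K k; rewrite (feval_mk (a := k n x) _) //; apply/esym/feval_mk.
- move=> n u IH uP.
  have vP : valid u by move=> K k; have [_ [b ub _]] := uP K k; exists b.
  exists (g n.+1 (fmk vP)) => //; rewrite -gfun_src; congr (g n _).
  apply: feval_inj => K k; rewrite feval_src.
  have [b ub] := vP K k; rewrite (feval_mk vP ub).
  by apply: feval_mk; exists b.
- move=> n u IH uP.
  have vP : valid u by move=> K k; have [_ [b ub _]] := uP K k; exists b.
  exists (g n.+1 (fmk vP)) => //; rewrite -gfun_tgt; congr (g n _).
  apply: feval_inj => K k; rewrite feval_tgt.
  have [b ub] := vP K k; rewrite (feval_mk vP ub).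
  by apply: feval_mk; exists b.
- move=> n j u IHu v IHv uvP.
  have uP : valid u.
    by move=> K k; have [_ [b [c [_ [_ [ub _ _]]]]]] := uvP K k; exists b.
  have vP : valid v.
    by move=> K k; have [_ [b [c [_ [_ [_ vc _]]]]]] := uvP K k; exists c.
  have [_ [_ [_ [ltjn _]]]] := uvP H f.
  have e : src_iter (ltnW ltjn) (fmk uP : free_gset n)
         = tgt_iter (ltnW ltjn) (fmk vP : free_gset n).
    apply: feval_inj => K k; have [_ [b [c [lt [e [ub vc _]]]]]] := uvP K k.
    rewrite feval_src_iter feval_tgt_iter /=.
    rewrite (feval_mk uP ub) (feval_mk vP vc).
    by rewrite (bool_irrelevance (ltnW ltjn) (ltnW lt)).
  exists (g n (fmk uP)), (g n (fmk vP)), ltjn, (gfun_composable g e).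
  split=> //; rewrite -(ifun_comp g e); congr (g n _).
  apply: feval_inj => K k; rewrite (feval_comp _ (feval_composable k e)).
  apply: feval_mk.
  have [b ub] := uP K k; have [c vc] := vP K k.
  exists (feval k (fmk uP)), (feval k (fmk vP)), ltjn, (feval_composable k e).
  by split=> //; rewrite ?(feval_mk uP ub) ?(feval_mk vP vc).
- move=> n u IH uP.
  have vP : valid u by move=> K k; have [_ [b ub _]] := uP K k; exists b.
  exists (g n (fmk vP)) => //; rewrite -ifun_id; congr (g n.+1 _).
  apply: feval_inj => K k; rewrite feval_id.
  have [b ub] := vP K k; rewrite (feval_mk vP ub).
  by apply: feval_mk; exists b.
- move=> n u IH uP.
  have vP : valid u by move=> K k; have [_ [b ub _]] := uP K k; exists b.
  exists (g n.+1 (fmk vP)) => //; apply: is_inverse_map.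
  apply: free_inverse => K k; have [a [b ub ba]] := uP K k.
  have ua : denotes k (TInv u) a by exists b.
  by rewrite (feval_mk vP ub) (feval_mk uP ua).
Qed.

Lemma free_ext_uniq (H : infty_groupoid) (f : globular_map G H)
    (g : infty_functor free_groupoid H) :
  globular_comp g free_unit = f -> g = free_ext f.
Proof.
move=> gf; apply/infty_functor_ext/globular_map_ext => n q /=.
rewrite -[X in g n X]fmk_repr; apply/esym.
apply: denotes_fun (feval_repr f q) _; exact: free_denotes.
Qed.

End FreeGroupoid.

(* [theta_tilde] is parametrised by an arbitrary left adjoint; there is one.   *)
Definition free_left_adjoint : left_adjoint forgetful :=
  @LeftAdjoint gset infty_groupoid_cat forgetful free_groupoid free_unit
    free_ext free_ext_unit free_ext_uniq.

Section ThetaTilde.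
Variable L : left_adjoint forgetful.

Definition theta_cat : category :=
  @Category table (fun S T => hom (L (gsum S)) (L (gsum T)))
    (fun S => idc (L (gsum S))) (fun S T U g f => g ∘ f)
    (fun _ _ _ _ h g f => compcA h g f)
    (fun _ _ f => compc1 f) (fun _ _ f => comp1c f).

(* L applied to D_m -> D_n, where D_n is identified with G_(n). *)
Definition theta_map m n (f : hom (disk m : gset) (disk n)) :
    hom (tdisk m : theta_cat) (tdisk n) :=
  ladj_map L (gsum_tdisk_map f).

Lemma theta_map_id n : theta_map (idc (disk n : gset)) = idc (tdisk n : theta_cat).
Proof. by rewrite /theta_map gsum_tdisk_map_id ladj_map_id. Qed.

Lemma theta_map_comp m n p (g : hom (disk n : gset) (disk p))
    (f : hom (disk m : gset) (disk n)) :
  theta_map (g ∘ f) = theta_map g ∘ theta_map f.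
Proof. by rewrite /theta_map gsum_tdisk_map_comp ladj_map_comp. Qed.

Definition theta_sigma n : hom (tdisk n : theta_cat) (tdisk n.+1) :=
  theta_map (gsigma (c := gset) n).

Definition theta_tau n : hom (tdisk n : theta_cat) (tdisk n.+1) :=
  theta_map (gtau (c := gset) n).

Lemma theta_sigma_sigma n :
  theta_sigma n.+1 ∘ theta_sigma n = theta_tau n.+1 ∘ theta_sigma n.
Proof. by rewrite -!theta_map_comp (@gsigma_sigma gset). Qed.

Lemma theta_sigma_tau n :
  theta_sigma n.+1 ∘ theta_tau n = theta_tau n.+1 ∘ theta_tau n.
Proof. by rewrite -!theta_map_comp (@gsigma_tau gset). Qed.

Definition theta_under : category_under_globe :=
  CategoryUnderGlobe theta_sigma_sigma theta_sigma_tau.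

Lemma theta_sigma_iter i j (le_ji : j <= i) :
  gsigma_iter theta_under le_ji = theta_map (gsigma_iter gset le_ji).
Proof.
have En d : gsigman theta_under d j = theta_map (gsigman gset d j).
  elim: d => [|d IH]; first by rewrite /= theta_map_id.
  apply: etrans (congr1 (fun g => theta_sigma (d + j) ∘ g) IH) _.
  exact: esym (theta_map_comp _ _).
rewrite /gsigma_iter; move: (i - j) (subnK le_ji) => d e.
by case: i / e le_ji => _; apply: En.
Qed.

Lemma theta_tau_iter i j (le_ji : j <= i) :
  gtau_iter theta_under le_ji = theta_map (gtau_iter gset le_ji).
Proof.
have En d : gtaun theta_under d j = theta_map (gtaun gset d j).
  elim: d => [|d IH]; first by rewrite /= theta_map_id.
  apply: etrans (congr1 (fun g => theta_tau (d + j) ∘ g) IH) _.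
  exact: esym (theta_map_comp _ _).
rewrite /gtau_iter; move: (i - j) (subnK le_ji) => d e.
by case: i / e le_ji => _; apply: En.
Qed.

Definition theta_leg (T : table) (l : 'I_(twidth T).+1) :
    hom (tdisk (tupper l) : theta_cat) T :=
  ladj_map L (gsum_tdisk_desc (leg (gsum_cocone T) l)).

Lemma theta_leg_map (T : table) n (l : 'I_(twidth T).+1)
    (f : hom (disk n : gset) (disk (tupper l))) :
  theta_leg l ∘ theta_map f
  = ladj_map L (gsum_tdisk_desc (leg (gsum_cocone T) l ∘ f)).
Proof.
apply: etrans (esym (ladj_map_comp L _ _)) _; congr (ladj_map L _).
apply: gsum_tdisk_ext.
by rewrite -compcA gsum_tdisk_mapE compcA !gsum_tdisk_descE.
Qed.

Lemma theta_leg_glue (T : table) (l : 'I_(twidth T)) :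
  theta_leg (lidx l) ∘ gsigma_iter theta_under (ltnW (tlower_ltl l))
  = theta_leg (ridx l) ∘ gtau_iter theta_under (ltnW (tlower_ltr l)).
Proof.
rewrite theta_sigma_iter theta_tau_iter.
apply: etrans (theta_leg_map _) (etrans _ (esym (theta_leg_map _))).
by rewrite (leg_glue (gsum_cocone T) l).
Qed.

Definition theta_cocone (T : table) : @cocone theta_under T T :=
  @Cocone theta_under T T (@theta_leg T) (@theta_leg_glue T).

(* The morphism D_n -> L(G_Y) corresponding to L(G_(n)) -> L(G_Y). *)
Definition theta_cell n (Y : table) (f : hom (tdisk n : theta_cat) Y) :
    hom (disk n : gset) (forgetful (L (gsum Y))) :=
  fmap forgetful f ∘ ladj_unit L (gsum (tdisk n)) ∘ gsum_tdisk_leg n.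

Lemma theta_cell_inj n (Y : table) (f g : hom (tdisk n : theta_cat) Y) :
  theta_cell f = theta_cell g -> f = g.
Proof. by move=> fg; apply: ladj_hom_ext; apply: gsum_tdisk_ext. Qed.

Lemma theta_cell_map m n (Y : table) (f : hom (disk m : gset) (disk n))
    (g : hom (tdisk n : theta_cat) Y) :
  theta_cell (g ∘ theta_map f) = theta_cell g ∘ f.
Proof.
rewrite /theta_cell /theta_map [fmap _ _](fmap_comp forgetful).
rewrite -[_ ∘ _ ∘ ladj_unit _ _]compcA ladj_map_unit.
by rewrite -!compcA gsum_tdisk_mapE.
Qed.

Lemma theta_cell_leg (T Y : table) (h : hom (T : theta_cat) Y) l :
  theta_cell (h ∘ theta_leg l)
  = fmap forgetful h ∘ ladj_unit L (gsum T) ∘ leg (gsum_cocone T) l.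
Proof.
rewrite /theta_cell /theta_leg [fmap _ _](fmap_comp forgetful).
rewrite -[_ ∘ _ ∘ ladj_unit _ _]compcA ladj_map_unit.
by rewrite -!compcA gsum_tdisk_descE.
Qed.

Lemma theta_colimit (T : table) : is_colimit (theta_cocone T).
Proof.
move=> Y c.
have glue l : theta_cell (leg c (lidx l)) ∘ gsigma_iter gset (ltnW (tlower_ltl l))
    = theta_cell (leg c (ridx l)) ∘ gtau_iter gset (ltnW (tlower_ltr l)).
  rewrite -!theta_cell_map -theta_sigma_iter -theta_tau_iter.
  by congr theta_cell; apply: (leg_glue c l).
pose c' := @Cocone gset T _ (fun l => theta_cell (leg c l)) glue.
exists (ladj_ext L (gsum_desc c' : hom (gsum T : gset) (forgetful _))).
split=> [l|h hE].
  apply: theta_cell_inj; rewrite theta_cell_leg ladj_ext_unit.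
  exact: (gsum_descE c' l).
apply/esym/ladj_ext_uniq/gsum_hom_ext => l.
rewrite -theta_cell_leg (gsum_descE c' l) /=; congr theta_cell; exact: hE.
Qed.

Program Definition theta_tilde : globular_extension :=
  @GlobularExtension theta_under _.
Next Obligation. by exists T, (theta_cocone T); apply: theta_colimit. Qed.

End ThetaTilde.

(* Main.v *)
From mathcomp Require Import all_boot boolp.
Require Import Defs.

(** Morphisms D_n -> S of Theta tilde are n-cells of the free groupoid L(G_S), and
    two of them are globularly parallel if the cells are parallel. The theorem
    therefore says that L(G_S) is acyclic (parallel cells are joined by a cell of
    the next dimension, [acyclic_gsum]) and that parallel m-cells of L(G_T) are
    equal once m is at least the dimension of T ([thin_gsum]).

    The globular sum G_T is built from a point by elementary expansions: given an
    n-cell x of the stage already reached, add an (n+1)-cell z with target x,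
    together with its source. Indeed D_(n+1) is such an expansion of D_n along
    tau, and the disks of a table are glued by means of the maps tau. On the level
    of free groupoids, an expansion i : X -> X' has the universal property that a
    morphism out of X' is a morphism f out of X together with a cell with target
    f x. So it suffices that expansions preserve acyclicity and, in dimensions
    above n, the equality of parallel cells.

    The map i has a retraction r, sending z to the identity of x. To compare i r
    with the identity of X', consider the n-th path groupoid of X': its cells
    below dimension n are those of X', its n-cells are the (n+1)-cells of X', and
    its higher cells are the squares d *_n a = b *_n c whose vertical sides a, b
    are (n+1)-cells. It is again a strict groupoid, so by the universal property
    of X' there is a morphism eta from X' to it with upper side c the identity and
    lower side d equal to i r ([expansion_homotopy]). Since a and b are
    invertible, a square is determined by a, b and d, and these can be prescribed;
    hence fillers of i r f, i r g yield fillers of f, g, and an equality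
    r f = r g yields f = g ([acyclic_expansion], [thin_expansion]).

    The path groupoid mixes cells of dimensions k and n+1. To avoid transports
    between dimensions, it is built for single-sorted groupoids, where cells of
    all dimensions are elements of the same type ([ssgpd], [squares]); a groupoid
    is made single-sorted by encoding a cell as the sequence of its iterated
    sources and identities ([threads]), and the way back takes the fixed points of
    the source operators ([cells_of]). *)

Set Implicit Arguments.
Unset Strict Implicit.
Unset Printing Implicit Defensive.

(** * Single-sorted strict groupoids *)

(** Composition is partial, but total functions are easier to rewrite with: the
    value d stands in wherever x does not satisfy P. *)
Definition mk_sig (A : Type) (P : A -> Prop) (d : sig P) (x : A) : sig P :=
  if pselect (P x) is left p then exist _ x p else d.

Lemma sval_mk_sig (A : Type) (P : A -> Prop) (d : sig P) (x : A) :
  P x -> sval (mk_sig d x) = x.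
Proof. by rewrite /mk_sig; case: pselect. Qed.

Lemma sval_inj (A : Type) (P : A -> Prop) (x y : sig P) : sval x = sval y -> x = y.
Proof.
case: x y => [x xP] [y yP] /= xy; case: y / xy yP => yP.
by rewrite (Prop_irrelevance xP yP).
Qed.

(** All cells live in one carrier, with no dimension in their type: [sbd false j]
    and [sbd true j] send a cell to its iterated j-dimensional source and target
    (seen as cells of any dimension through identities), and a k-cell is an
    element fixed by [sbd false k]. The composite [scomp j u v] is meaningful only
    if [sbd false j u = sbd true j v]. *)
Record ssgpd := SSGpd {
  ss_car :> Type;
  sbd : bool -> nat -> ss_car -> ss_car;
  scomp : nat -> ss_car -> ss_car -> ss_car;
  sbd_lt : forall b b' i j x, i < j -> sbd b i (sbd b' j x) = sbd b i x;
  sbd_ge : forall b b' i j x, j <= i -> sbd b i (sbd b' j x) = sbd b' j x;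
  scomp_src : forall j u v,
    sbd false j u = sbd true j v -> sbd false j (scomp j u v) = sbd false j v;
  scomp_tgt : forall j u v,
    sbd false j u = sbd true j v -> sbd true j (scomp j u v) = sbd true j u;
  scomp_bd : forall b i j u v, j < i -> sbd false j u = sbd true j v ->
    sbd b i (scomp j u v) = scomp j (sbd b i u) (sbd b i v);
  scompA : forall j u v w,
    sbd false j u = sbd true j v -> sbd false j v = sbd true j w ->
    scomp j (scomp j u v) w = scomp j u (scomp j v w);
  scomp1l : forall j u, scomp j (sbd true j u) u = u;
  scomp1r : forall j u, scomp j u (sbd false j u) = u;
  scomp_exchange : forall j k u u' v v', k < j ->
    sbd false j u = sbd true j u' -> sbd false j v = sbd true j v' ->
    sbd false k u = sbd true k v ->
    scomp k (scomp j u u') (scomp j v v') = scomp j (scomp k u v) (scomp k u' v');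
  sinv_ex : forall i u, sbd false i.+1 u = u -> exists v,
    [/\ sbd false i.+1 v = v, sbd false i v = sbd true i u,
        sbd true i v = sbd false i u, scomp i v u = sbd false i u
      & scomp i u v = sbd true i u] }.

Section SingleSortedTheory.
Variable W : ssgpd.
Implicit Types u v w x : W.

Lemma sbd_le b i j x : i <= j -> sbd b i (sbd b j x) = sbd b i x.
Proof. by rewrite leq_eqVlt => /orP[/eqP ->|/sbd_lt ->] //; rewrite sbd_ge. Qed.

Lemma sbd_id b i j x : j <= i -> sbd false j x = x -> sbd b i x = x.
Proof. by move=> ji <-; rewrite sbd_ge. Qed.

Lemma sbd_idb b b' j x : sbd b j x = x -> sbd b' j x = x.
Proof. by move=> <-; rewrite sbd_ge. Qed.

Lemma scomp_bd_lt b i j u v : i < j -> sbd false j u = sbd true j v ->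
  sbd b i (scomp j u v) = sbd b i v.
Proof. by move=> ij uv; rewrite -(sbd_lt b false _ ij) scomp_src // sbd_lt. Qed.

Lemma composable_lt b i j u v : i < j -> sbd false j u = sbd true j v ->
  sbd b i u = sbd b i v.
Proof. by move=> ij uv; rewrite -(sbd_lt b false u ij) uv sbd_lt. Qed.

Lemma scomp_diag j u : sbd false j u = u -> scomp j u u = u.
Proof. by move=> uj; rewrite -{2}uj scomp1r. Qed.

Lemma scomp_cancel n (b c c' : W) : sbd false n.+1 b = b ->
  sbd false n b = sbd true n c -> sbd false n b = sbd true n c' ->
  scomp n b c = scomp n b c' -> c = c'.
Proof.
move=> /sinv_ex [b' [_ sb' _ b'b _]] bc bc' E.
by rewrite -[c](scomp1l n) -[c'](scomp1l n) -bc -bc' -b'b !scompA // E.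
Qed.

(** Multiplying by the inverse of b solves b *_n d = c. *)
Lemma scomp_solve n (b c : W) : sbd false n.+1 b = b ->
  sbd true n b = sbd true n c ->
  exists d, [/\ sbd true n d = sbd false n b, sbd false n d = sbd false n c
    & scomp n b d = c].
Proof.
move=> bn bc; have [b' [b'n sb' tb' b'b bb']] := sinv_ex bn.
have b'c : sbd false n b' = sbd true n c by rewrite sb'.
exists (scomp n b' c); split; first by rewrite scomp_tgt.
- by rewrite scomp_src.
by rewrite -scompA // bb' bc scomp1l.
Qed.

(** Inverses are only postulated one dimension below a cell. For u : a -> b with
    u' inverse to u for *_(k+1) and a', b' inverse to a, b for *_k, the composite
    a' * u' * b' is a *_k-inverse of u: writing u as u *_(k+1) a or b *_(k+1) u
    and exchanging, the composites collapse to (u *_(k+1) u') * b' and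
    a' * (u' *_(k+1) u). *)
Lemma sinv2_ex k u : sbd false k.+2 u = u -> exists v,
  [/\ sbd false k.+2 v = v, sbd false k v = sbd true k u,
      sbd true k v = sbd false k u, scomp k v u = sbd false k u
    & scomp k u v = sbd true k u].
Proof.
move=> u2.
have [u' [u'2 su' tu' u'u uu']] := sinv_ex u2.
pose a := sbd false k.+1 u; pose b := sbd true k.+1 u.
have a1 : sbd false k.+1 a = a by rewrite sbd_ge.
have b1 : sbd false k.+1 b = b by rewrite sbd_ge.
have [a' [a'1 sa' ta' a'a aa']] := sinv_ex a1.
have [b' [b'1 sb' tb' b'b bb']] := sinv_ex b1.
have sk : sbd false k a = sbd false k u by rewrite sbd_lt.
have tk : sbd true k a = sbd true k u by rewrite sbd_lt.
have skb : sbd false k b = sbd false k u by rewrite sbd_lt.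
have tkb : sbd true k b = sbd true k u by rewrite sbd_lt.
have sku' : sbd false k u' = sbd false k u.
  by rewrite -skb -[b]su' sbd_lt.
have tku' : sbd true k u' = sbd true k u by rewrite -tkb -[b]su' sbd_lt.
rewrite -/a -/b in su' tu' u'u uu'.
have c1 : sbd false k a' = sbd true k u' by rewrite sa' tk tku'.
have c2 : sbd false k u' = sbd true k b' by rewrite tb' skb.
have c2' : sbd false k (scomp k a' u') = sbd true k b' by rewrite scomp_src // c2.
pose v := scomp k (scomp k a' u') b'.
have vE : v = scomp k a' (scomp k u' b') by rewrite /v scompA.
have sv : sbd false k v = sbd true k u by rewrite scomp_src // sb' tkb.
have tv : sbd true k v = sbd false k u.
  by rewrite scomp_tgt // scomp_tgt // ta' sk.
have vbd b0 i : k < i -> sbd b0 i v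
    = scomp k (scomp k (sbd b0 i a') (sbd b0 i u')) (sbd b0 i b').
  by move=> ki; rewrite (scomp_bd _ ki c2') (scomp_bd _ ki c1).
have a'1' b0 : sbd b0 k.+1 a' = a' by apply: sbd_id a'1.
have b'1' b0 : sbd b0 k.+1 b' = b' by apply: sbd_id b'1.
have v2 : sbd false k.+2 v = v.
  by rewrite vbd // u'2 (sbd_id _ _ a'1) // (sbd_id _ _ b'1).
have sv1 : sbd false k.+1 v = a'.
  rewrite vbd // a'1' b'1' su' scompA ?bb' //; last by rewrite sa' tk tkb.
  by rewrite tkb -tk -sa' scomp1r.
have tv1 : sbd true k.+1 v = b'.
  by rewrite vbd // a'1' b'1' tu' a'a sk -skb -tb' scomp1l.
exists v; split=> //.
- have -> : scomp k v u = scomp k (scomp k.+1 v a') (scomp k.+1 b u).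
    by rewrite -{1}sv1 scomp1r [b]/(sbd true k.+1 u) scomp1l.
  rewrite scomp_exchange ?sv1 ?a'1' // ?b1 //; last by rewrite sv tkb.
  have -> : scomp k v b = scomp k a' u'.
    by rewrite /v scompA ?b'b // ?sb' // skb -sku' -(scomp_src c1) scomp1r.
  have -> : scomp k.+1 (scomp k a' u') (scomp k a' u)
            = scomp k (scomp k.+1 a' a') (scomp k.+1 u' u).
    by apply/esym/scomp_exchange; rewrite ?a'1' //.
  by rewrite scomp_diag // u'u a'a sk.
have -> : scomp k u v = scomp k (scomp k.+1 u a) (scomp k.+1 b' v).
  by rewrite scomp1r -[b' in RHS]tv1 scomp1l.
rewrite scomp_exchange // ?b'1' ?tv1 // ?[sbd true _ a](sbd_idb _ a1) //;
  last by rewrite tb' skb.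
have -> : scomp k a v = scomp k u' b'.
  have E : sbd false k a' = sbd true k (scomp k u' b') by rewrite scomp_tgt.
  by rewrite vE -(scompA (esym ta') E) aa' tk -tku' -(scomp_tgt c2) scomp1l.
have -> : scomp k.+1 (scomp k u b') (scomp k u' b')
   = scomp k (scomp k.+1 u u') (scomp k.+1 b' b').
  by apply/esym/scomp_exchange; rewrite ?b'1' // tb' skb.
by rewrite uu' scomp_diag // bb' tkb.
Qed.

End SingleSortedTheory.

(** * The groupoid of cells of a single-sorted groupoid *)

Section CellsOf.
Variable W : ssgpd.

(** Iterated sources, targets and identities do not move the underlying element
    except through [sbd], so that every axiom below reduces to its single-sorted
    counterpart. *)
Definition ss_cell (k : nat) : Type := {x : W | sbd false k x = x}.

Definition ss_cell_bd b k (x : ss_cell k.+1) : ss_cell k :=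
  exist _ (sbd b k (sval x)) (sbd_ge false b (sval x) (leqnn k)).

Program Definition ss_gset : globular_set :=
  @GlobularSet ss_cell (ss_cell_bd false) (ss_cell_bd true) _ _.
Next Obligation. by apply: sval_inj; rewrite /= !sbd_lt. Qed.
Next Obligation. by apply: sval_inj; rewrite /= !sbd_lt. Qed.

Lemma sval_srcn d j (x : ss_gset (d + j)) :
  sval (srcn x) = sbd false j (sval x).
Proof.
elim: d x => [x|d IH x] /=; first by rewrite (svalP x).
by rewrite IH /= sbd_le // leq_addl.
Qed.

Lemma sval_tgtn d j (x : ss_gset (d + j)) :
  sval (tgtn x) = sbd true j (sval x).
Proof.
elim: d x => [x|d IH x] /=; first by rewrite (sbd_idb true (svalP x)).
by rewrite IH /= sbd_le // leq_addl.
Qed.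

Lemma sval_ecast m n (e : m = n) (x : ss_gset m) :
  sval (ecast k (ss_gset k) e x) = sval x.
Proof. by case: n / e. Qed.

Lemma sval_src_iter i j (le_ji : j <= i) (x : ss_gset i) :
  sval (src_iter le_ji x) = sbd false j (sval x).
Proof. by rewrite /src_iter sval_srcn sval_ecast. Qed.

Lemma sval_tgt_iter i j (le_ji : j <= i) (x : ss_gset i) :
  sval (tgt_iter le_ji x) = sbd true j (sval x).
Proof. by rewrite /tgt_iter sval_tgtn sval_ecast. Qed.

Definition ss_id k (x : ss_gset k) : ss_gset k.+1 :=
  exist _ (sval x) (sbd_id _ (leqnSn k) (svalP x)).

Lemma sval_id_iter i j (le_ji : j <= i) (x : ss_gset j) :
  sval (id_iter ss_id le_ji x) = sval x.
Proof. by rewrite /id_iter sval_ecast; elim: (i - j). Qed.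

Lemma ss_composable i j (le_ji : j <= i) (u v : ss_gset i) :
  src_iter le_ji u = tgt_iter le_ji v ->
  sbd false j (sval u) = sbd true j (sval v).
Proof. by rewrite -(sval_src_iter le_ji) -(sval_tgt_iter le_ji) => ->. Qed.

Lemma ss_comp_subproof i j (ltji : j < i) (u v : ss_gset i) :
  src_iter (ltnW ltji) u = tgt_iter (ltnW ltji) v ->
  sbd false i (scomp j (sval u) (sval v)) = scomp j (sval u) (sval v).
Proof.
by move/ss_composable => uv; rewrite (scomp_bd _ ltji uv) (svalP u) (svalP v).
Qed.

Definition ss_comp i j (ltji : j < i) (u v : ss_gset i)
    (e : src_iter (ltnW ltji) u = tgt_iter (ltnW ltji) v) : ss_gset i :=
  exist _ (scomp j (sval u) (sval v)) (ss_comp_subproof e).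

Program Definition ss_cat : infty_category :=
  @InftyCategory ss_gset ss_comp ss_id _ _ _ _ _ _ _ _ _ _ _.
Next Obligation.
by apply: sval_inj; rewrite /= scomp_src //; apply: ss_composable e.
Qed.
Next Obligation.
by apply: sval_inj; rewrite /= scomp_tgt //; apply: ss_composable e.
Qed.
Next Obligation.
by apply: sval_inj; rewrite /= scomp_bd //; apply: ss_composable e.
Qed.
Next Obligation.
by apply: sval_inj; rewrite /= scomp_bd //; apply: ss_composable e.
Qed.
Next Obligation. by apply: sval_inj; rewrite /= (svalP u). Qed.
Next Obligation.
by apply: sval_inj; rewrite /= (sbd_idb true (svalP u)).
Qed.
Next Obligation.
apply: sval_inj; rewrite /= scompA //; first exact: ss_composable euv.
exact: ss_composable evw.
Qed.
Next Obligation.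
apply: sval_inj; rewrite /= scomp_exchange //.
- exact: ss_composable e1.
- exact: ss_composable e2.
exact: ss_composable e4.
Qed.
Next Obligation.
by apply: sval_inj; rewrite /= sval_id_iter sval_tgt_iter scomp1l.
Qed.
Next Obligation.
by apply: sval_inj; rewrite /= sval_id_iter sval_src_iter scomp1r.
Qed.
Next Obligation. exact: sval_inj. Qed.

Program Definition cells_of : infty_groupoid := @InftyGroupoid ss_cat _.
Next Obligation.
have [v [v1 sv tv vu uv]] := sinv_ex (svalP u).
pose v' : ss_gset i.+1 := exist _ v v1.
exists (v' : ss_cat i.+1); split.
  have e : src_iter (ltnW (ltnSn i)) v' = tgt_iter (ltnW (ltnSn i)) (u : ss_gset i.+1).
    by apply: sval_inj; rewrite sval_src_iter sval_tgt_iter.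
  by exists e; apply: sval_inj.
have e : src_iter (ltnW (ltnSn i)) (u : ss_gset i.+1) = tgt_iter (ltnW (ltnSn i)) v'.
  by apply: sval_inj; rewrite sval_src_iter sval_tgt_iter.
by exists e; apply: sval_inj.
Qed.

End CellsOf.

Record ss_mor (W V : ssgpd) := SSMor {
  ss_fun :> W -> V;
  ss_fun_bd : forall b k x, ss_fun (sbd b k x) = sbd b k (ss_fun x);
  ss_fun_comp : forall k u v, sbd false k u = sbd true k v ->
    ss_fun (scomp k u v) = scomp k (ss_fun u) (ss_fun v) }.

Section CellsOfMap.
Variables (W V : ssgpd) (f : ss_mor W V).

Lemma cells_map_subproof k (x : cells_of W k) :
  sbd false k (f (sval x)) = f (sval x).
Proof. by rewrite -ss_fun_bd (svalP x). Qed.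

Program Definition cells_gmap : globular_map (cells_of W) (cells_of V) :=
  @GlobularMap (cells_of W) (cells_of V)
    (fun k x => exist _ (f (sval x)) (cells_map_subproof x)) _ _.
Next Obligation. by apply: sval_inj; rewrite /= ss_fun_bd. Qed.
Next Obligation. by apply: sval_inj; rewrite /= ss_fun_bd. Qed.

Program Definition cells_map : infty_functor (cells_of W) (cells_of V) :=
  @InftyFunctor (cells_of W) (cells_of V) cells_gmap _ _.
Next Obligation.
apply: sval_inj; rewrite /= ss_fun_comp //; exact: ss_composable e.
Qed.
Next Obligation. exact: sval_inj. Qed.

End CellsOfMap.

(** * The single-sorted groupoid of a groupoid *)

Section IteratedLemmas.
Variable X : globular_set.

Lemma src_iterE d j (le : j <= d + j) (x : X (d + j)) : src_iter le x = srcn x.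
Proof.
rewrite /src_iter; move: (subnK le) => e; have dE : d + j - j = d by rewrite addnK.
by move: (d + j - j) dE e => d' -> e; rewrite (eq_irrelevance e erefl).
Qed.

Lemma tgt_iterE d j (le : j <= d + j) (x : X (d + j)) : tgt_iter le x = tgtn x.
Proof.
rewrite /tgt_iter; move: (subnK le) => e; have dE : d + j - j = d by rewrite addnK.
by move: (d + j - j) dE e => d' -> e; rewrite (eq_irrelevance e erefl).
Qed.

Lemma id_iterE (f : forall n, X n -> X n.+1) d j (le : j <= d + j) (x : X j) :
  id_iter f le x = iidn f d x.
Proof.
rewrite /id_iter; move: (subnK le) => e; have dE : d + j - j = d by rewrite addnK.
by move: (d + j - j) dE e => d' -> e; rewrite (eq_irrelevance e erefl).
Qed.

Lemma leq_addE j i : j <= i -> exists d, i = d + j.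
Proof. by move=> le; exists (i - j); rewrite subnK. Qed.

Lemma src_iter_refl i (le : i <= i) (x : X i) : src_iter le x = x.
Proof. exact: (@src_iterE 0 i). Qed.

Lemma src_iterS i j (le : j <= i.+1) (le' : j <= i) (x : X i.+1) :
  src_iter le x = src_iter le' (src x).
Proof.
have [d E] := leq_addE le'; subst i.
by rewrite src_iterE (@src_iterE d.+1).
Qed.

Lemma tgt_iterS i j (le : j <= i.+1) (le' : j <= i) (x : X i.+1) :
  tgt_iter le x = tgt_iter le' (tgt x).
Proof.
have [d E] := leq_addE le'; subst i.
by rewrite tgt_iterE (@tgt_iterE d.+1).
Qed.

Lemma tgt_iter_src i j (le : j <= i.+1) (lt : j < i) (x : X i.+1) :
  tgt_iter le x = tgt_iter (ltnW lt) (src x).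
Proof.
rewrite (tgt_iterS _ (ltnW lt)); case: i le lt x => // i le lt x.
by rewrite !(tgt_iterS _ (lt : j <= i)) tgt_src.
Qed.

Lemma src_src_iter i j (le : j.+1 <= i) (le' : j <= i) (x : X i) :
  src (src_iter le x) = src_iter le' x.
Proof.
elim: i le le' x => // i IH le le' x.
have := le; rewrite ltnS leq_eqVlt => /orP[/eqP ji|ji].
  subst i.
  by rewrite src_iter_refl src_iterS src_iter_refl.
by rewrite (src_iterS _ ji) (src_iterS _ (ltnW ji)); apply: IH.
Qed.

Variable f : forall n, X n -> X n.+1.

Lemma id_iter_refl i (le : i <= i) (x : X i) : id_iter f le x = x.
Proof. exact: (@id_iterE f 0 i). Qed.

Lemma id_iterS i j (le : j <= i.+1) (le' : j <= i) (x : X j) :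
  id_iter f le x = f (id_iter f le' x).
Proof.
have [d E] := leq_addE le'; subst i.
by rewrite id_iterE (@id_iterE f d.+1).
Qed.

End IteratedLemmas.

Section Thread.
Variable Y : infty_groupoid.

(** An n-cell is encoded as the sequence of its iterated sources (below n), itself
    (at n) and its iterated identities (above n). Cells of different dimensions
    can then be compared level by level, with no transport between dimensions.
    Sequences that never become identities are harmless: the n-cells of the
    resulting single-sorted groupoid are exactly the n-cells of Y. *)
Definition threadP (u : forall k, Y k) : Prop := forall k, src (u k.+1) = u k.

Definition thread := {u | threadP u}.

Definition level (u : thread) k : Y k := sval u k.

Lemma level_src u k : src (level u k.+1) = level u k.
Proof. exact: svalP u k. Qed.

Lemma thread_ext u v : (forall k, level u k = level v k) -> u = v.
Proof. by move=> uv; apply/sval_inj/functional_extensionality_dep. Qed.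

Definition pad j (y : forall k, Y k) : forall k, Y k :=
  fix pad k := if k is k'.+1 return Y k then
    if k'.+1 <= j then y k'.+1 else iid (pad k') else y 0.

Lemma pad_le j (y : forall k, Y k) k : k <= j -> pad j y k = y k.
Proof. by case: k => //= k ->. Qed.

Lemma pad_gt j (y : forall k, Y k) k : j <= k -> pad j y k.+1 = iid (pad j y k).
Proof. by move=> /= jk; rewrite ltnNge jk. Qed.

Lemma padP j (y : forall k, Y k) :
  (forall k, k < j -> src (y k.+1) = y k) -> threadP (pad j y).
Proof.
move=> yP k; case: (leqP j k) => jk; first by rewrite pad_gt // iid_src.
by rewrite !pad_le ?yP // ltnW.
Qed.

Definition bdseq b j (u : thread) k : Y k :=
  if b && (k == j) then tgt (level u k.+1) else level u k.

Lemma bdseqP b j (u : thread) k : k < j -> src (bdseq b j u k.+1) = bdseq b j u k.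
Proof.
move=> kj; rewrite /bdseq (ltn_eqF kj) andbF.
by case: ifP => _; rewrite ?src_tgt !level_src.
Qed.

Definition thread_bd b j (u : thread) : thread :=
  exist _ (pad j (bdseq b j u)) (padP (bdseqP b u)).

Lemma level_bd_lt b j u k : k < j -> level (thread_bd b j u) k = level u k.
Proof.
by move=> kj; rewrite /level /= pad_le ?(ltnW kj) // /bdseq (ltn_eqF kj) andbF.
Qed.

Lemma level_bd_src j u : level (thread_bd false j u) j = level u j.
Proof. by rewrite /level /= pad_le. Qed.

Lemma level_bd_tgt j u : level (thread_bd true j u) j = tgt (level u j.+1).
Proof. by rewrite /level /= pad_le // /bdseq eqxx. Qed.

Lemma level_bd_gt b j u k : j <= k ->
  level (thread_bd b j u) k.+1 = iid (level (thread_bd b j u) k).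
Proof. by move=> jk; rewrite {1}/level [sval _ _]pad_gt. Qed.

(** Sources determine the levels below j, identities those above. *)
Lemma thread_eq j u v :
  (forall k, j <= k -> level u k.+1 = iid (level u k)) ->
  (forall k, j <= k -> level v k.+1 = iid (level v k)) ->
  level u j = level v j -> u = v.
Proof.
move=> uj vj uv; apply: thread_ext => k; case: (leqP j k) => [jk|/ltnW kj].
  elim: k jk => [|k IH]; first by rewrite leqn0 => /eqP <-.
  rewrite leq_eqVlt ltnS => /orP[/eqP <- //|jk]; by rewrite uj // vj // IH.
elim: j kj uv {uj vj} => [|j IH]; first by rewrite leqn0 => /eqP ->.
rewrite leq_eqVlt ltnS => /orP[/eqP -> //|kj] uv.
by apply: IH => //; rewrite -[level u j]level_src -[level v j]level_src uv.
Qed.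

Lemma tgt_level_bd b i j u : i < j ->
  tgt (level (thread_bd b j u) i.+1) = tgt (level u i.+1).
Proof.
rewrite leq_eqVlt => /orP[/eqP <-|ij]; last by rewrite level_bd_lt.
case: b; last by rewrite level_bd_src.
by rewrite level_bd_tgt -tgt_src level_src.
Qed.

Lemma thread_bd_lt b b' i j u :
  i < j -> thread_bd b i (thread_bd b' j u) = thread_bd b i u.
Proof.
move=> ij; apply: (thread_eq (j := i)) => [k|k|]; [exact: level_bd_gt..|].
case: b; last by rewrite !level_bd_src level_bd_lt.
by rewrite !level_bd_tgt tgt_level_bd.
Qed.

Lemma thread_bd_id b i u :
  (forall k, i <= k -> level u k.+1 = iid (level u k)) -> thread_bd b i u = u.
Proof.
move=> ui; apply: (thread_eq (j := i)) => // [k|]; first exact: level_bd_gt.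
case: b; last by rewrite level_bd_src.
by rewrite level_bd_tgt ui // iid_tgt.
Qed.

Lemma thread_bd_ge b b' i j u :
  j <= i -> thread_bd b i (thread_bd b' j u) = thread_bd b' j u.
Proof.
move=> ji; apply: thread_bd_id => k ik; apply: level_bd_gt; exact: leq_trans ik.
Qed.

(** The default y is the right value at the levels k <= j: there the composite
    x *_j y has the same iterated sources as y. *)
Definition lcomp j k (x y : Y k) : Y k :=
  if pselect (j < k) is left lt then
    if pselect (src_iter (ltnW lt) x = tgt_iter (ltnW lt) y) is left e
    then icomp lt x y e else y
  else y.

Lemma lcompE j k (lt : j < k) (x y : Y k) e : lcomp j x y = icomp lt x y e.
Proof.
rewrite /lcomp; case: pselect => // lt'; case: pselect => [e'|ne].
  move: e; rewrite (bool_irrelevance lt lt') => e; exact: icomp_congr.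
by case: ne; rewrite (bool_irrelevance (ltnW lt') (ltnW lt)).
Qed.

Lemma lcomp_ge j k (x y : Y k) : k <= j -> lcomp j x y = y.
Proof. by rewrite /lcomp leqNgt; case: pselect => // lt; rewrite lt. Qed.

Definition thread_comp j (u v : thread) : thread :=
  mk_sig u (fun k => lcomp j (level u k) (level v k)).

Lemma src_iter_level u i j (le : j <= i) : src_iter le (level u i) = level u j.
Proof.
elim: i le => [|i IH] le.
  by have := le; rewrite leqn0 => /eqP E; subst j; rewrite src_iter_refl.
have := le; rewrite leq_eqVlt => /orP[/eqP E|ji].
  by subst j; rewrite src_iter_refl.
by rewrite (src_iterS _ (ji : j <= i)) level_src IH.
Qed.

Lemma tgt_iter_level u i j (lt : j < i) :
  tgt_iter (ltnW lt) (level u i) = tgt (level u j.+1).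
Proof.
elim: i lt => [//|i IH] lt.
have := lt; rewrite ltnS leq_eqVlt => /orP[/eqP E|ji].
  by subst j; rewrite tgt_iter1.
by rewrite (tgt_iter_src _ ji) level_src IH.
Qed.

Lemma thread_composableP j u v :
  (thread_bd false j u = thread_bd true j v) <-> (level u j = tgt (level v j.+1)).
Proof.
rewrite -level_bd_src -level_bd_tgt; split=> [-> //|].
by apply: thread_eq => k; apply: level_bd_gt.
Qed.

Lemma level_composable j u v k (lt : j < k) :
  thread_bd false j u = thread_bd true j v ->
  src_iter (ltnW lt) (level u k) = tgt_iter (ltnW lt) (level v k).
Proof. by move/thread_composableP; rewrite src_iter_level tgt_iter_level. Qed.

Lemma thread_comp_subproof j u v : thread_bd false j u = thread_bd true j v ->
  threadP (fun k => lcomp j (level u k) (level v k)).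
Proof.
move=> uv k; case: (leqP k.+1 j) => [kj|].
  by rewrite !lcomp_ge ?level_src // ltnW.
rewrite ltnS leq_eqVlt => /orP[/eqP E|jk].
  subst j; rewrite (lcompE (level_composable (ltnSn k) uv)) icomp_src_top.
  by rewrite lcomp_ge ?level_src.
have lt := ltnW jk : j < k.+1.
rewrite (lcompE (level_composable lt uv)) (lcompE (level_composable jk uv)).
have E := level_composable jk uv; rewrite -(level_src u) -(level_src v) in E.
by rewrite (icomp_src _ E); apply: icomp_congr; rewrite level_src.
Qed.

Lemma level_compE j u v k : thread_bd false j u = thread_bd true j v ->
  level (thread_comp j u v) k = lcomp j (level u k) (level v k).
Proof.
by move=> uv; rewrite /level /thread_comp sval_mk_sig //; apply: thread_comp_subproof.
Qed.

Lemma thread_comp_src j u v : thread_bd false j u = thread_bd true j v ->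
  thread_bd false j (thread_comp j u v) = thread_bd false j v.
Proof.
move=> uv; apply: (thread_eq (j := j)) => [k|k|]; [exact: level_bd_gt..|].
by rewrite !level_bd_src level_compE // lcomp_ge.
Qed.

Lemma thread_comp_tgt j u v : thread_bd false j u = thread_bd true j v ->
  thread_bd true j (thread_comp j u v) = thread_bd true j u.
Proof.
move=> uv; apply: (thread_eq (j := j)) => [k|k|]; [exact: level_bd_gt..|].
rewrite !level_bd_tgt level_compE // (lcompE (level_composable (ltnSn j) uv)).
exact: icomp_tgt_top.
Qed.

Lemma thread_comp_cell i j u v : j < i -> thread_bd false j u = thread_bd true j v ->
  (forall k, i <= k -> level u k.+1 = iid (level u k)) ->
  (forall k, i <= k -> level v k.+1 = iid (level v k)) ->
  forall k, i <= k ->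
    level (thread_comp j u v) k.+1 = iid (level (thread_comp j u v) k).
Proof.
move=> ji uv ui vi k ik; rewrite !level_compE //.
have jk := leq_trans ji ik.
have lt : j < k.+1 by apply: ltnW.
rewrite (lcompE (level_composable lt uv)) (lcompE (level_composable jk uv)).
have E := level_composable lt uv; rewrite ui // vi // in E.
by rewrite (iid_comp _ E); apply: icomp_congr; [apply: ui|apply: vi].
Qed.

Lemma thread_comp_bd b i j u v :
  j < i -> thread_bd false j u = thread_bd true j v ->
  thread_bd b i (thread_comp j u v)
  = thread_comp j (thread_bd b i u) (thread_bd b i v).
Proof.
move=> ji uv.
have uv' : thread_bd false j (thread_bd b i u) = thread_bd true j (thread_bd b i v).
  by rewrite !thread_bd_lt.
apply: (thread_eq (j := i)) => [k|k|]; first exact: level_bd_gt.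
  move=> ik; apply: thread_comp_cell ji uv' _ _ k ik => k ik; exact: level_bd_gt.
rewrite level_compE //; case: b uv' => uv'; last first.
  by rewrite !level_bd_src level_compE.
rewrite !level_bd_tgt level_compE //.
have lt : j < i.+1 by apply: ltnW.
rewrite (lcompE (level_composable lt uv)).
have E := level_composable ji uv'; rewrite !level_bd_tgt in E.
by rewrite (lcompE E); apply: icomp_tgt.
Qed.

Lemma thread_compA j u v w :
  thread_bd false j u = thread_bd true j v ->
  thread_bd false j v = thread_bd true j w ->
  thread_comp j (thread_comp j u v) w = thread_comp j u (thread_comp j v w).
Proof.
move=> uv vw; apply: thread_ext => k.
have uvw : thread_bd false j (thread_comp j u v) = thread_bd true j w.
  by rewrite thread_comp_src.
have uvw' : thread_bd false j u = thread_bd true j (thread_comp j v w).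
  by rewrite thread_comp_tgt.
case: (leqP k j) => [kj|jk]; first by rewrite !(level_compE, lcomp_ge).
have E := level_composable jk uvw; have E' := level_composable jk uvw'.
rewrite level_compE // (lcompE E) [RHS]level_compE // (lcompE E').
have e1 := level_composable jk uv; have e2 := level_composable jk vw.
rewrite !level_compE // (lcompE e1) in E *.
rewrite !level_compE // (lcompE e2) in E' *.
exact: icompA.
Qed.

(** From level j on, a boundary consists of the iterated identities that the unit
    axioms of Y mention. *)
Lemma level_bd_id b j u k (le : j <= k) :
  level (thread_bd b j u) k = id_iter (@iid Y) le (level (thread_bd b j u) j).
Proof.
elim: k le => [|k IH] le.
  by have := le; rewrite leqn0 => /eqP E; subst j; rewrite id_iter_refl.
have := le; rewrite leq_eqVlt => /orP[/eqP E|jk].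
  by subst j; rewrite id_iter_refl.
by rewrite level_bd_gt // (id_iterS _ _ (jk : j <= k)) IH.
Qed.

Lemma thread_comp1l j u : thread_comp j (thread_bd true j u) u = u.
Proof.
have uv : thread_bd false j (thread_bd true j u) = thread_bd true j u.
  exact: thread_bd_ge.
apply: thread_ext => k; rewrite level_compE //.
case: (leqP k j) => [kj|jk]; first by rewrite lcomp_ge.
have e := level_composable jk uv.
have E : level (thread_bd true j u) k
    = id_iter (@iid Y) (ltnW jk) (tgt_iter (ltnW jk) (level u k)).
  by rewrite tgt_iter_level -level_bd_tgt -level_bd_id.
by rewrite (lcompE e); move: e; rewrite E => e; rewrite icomp1l.
Qed.

Lemma thread_comp1r j u : thread_comp j u (thread_bd false j u) = u.
Proof.
have uv : thread_bd false j u = thread_bd true j (thread_bd false j u).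
  by rewrite thread_bd_ge.
apply: thread_ext => k; rewrite level_compE //.
case: (leqP k j) => [|jk].
  rewrite leq_eqVlt => /orP[/eqP ->|kj]; rewrite lcomp_ge ?level_bd_src //.
    by rewrite level_bd_lt.
  exact: ltnW.
have e := level_composable jk uv.
have E : level (thread_bd false j u) k
    = id_iter (@iid Y) (ltnW jk) (src_iter (ltnW jk) (level u k)).
  by rewrite src_iter_level -[level u j]level_bd_src -level_bd_id.
by rewrite (lcompE e); move: e; rewrite E => e; rewrite icomp1r.
Qed.

Lemma thread_exchange j k u u' v v' : k < j ->
  thread_bd false j u = thread_bd true j u' ->
  thread_bd false j v = thread_bd true j v' ->
  thread_bd false k u = thread_bd true k v ->
  thread_comp k (thread_comp j u u') (thread_comp j v v')
  = thread_comp j (thread_comp k u v) (thread_comp k u' v').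
Proof.
move=> kj uu vv uv.
have lt1 b j' x y : thread_bd false j x = thread_bd true j y -> j' < j ->
    thread_bd b j' x = thread_bd b j' y.
  by move=> xy lt; rewrite -(thread_bd_lt b false x lt) xy thread_bd_lt.
have uv' : thread_bd false k u' = thread_bd true k v'.
  by rewrite -(lt1 _ _ _ _ uu kj) -(lt1 _ _ _ _ vv kj).
have e3 : thread_bd false k (thread_comp j u u') = thread_bd true k (thread_comp j v v').
  rewrite -(thread_bd_lt false false _ kj) -(thread_bd_lt true false (thread_comp j v v') kj).
  by rewrite !thread_comp_src // !thread_bd_lt.
have e6 : thread_bd false j (thread_comp k u v) = thread_bd true j (thread_comp k u' v').
  by rewrite !thread_comp_bd // uu vv.
apply: thread_ext => l; case: (leqP l j) => [lj|jl].
  rewrite (level_compE _ e3) (level_compE _ e6) (level_compE _ uu).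
  by rewrite (level_compE _ vv) !(lcomp_ge _ _ lj) (level_compE _ uv').
have kl := ltn_trans kj jl.
have f1 := level_composable jl uu; have f2 := level_composable jl vv.
have f3 := level_composable kl e3; have f4 := level_composable kl uv.
have f5 := level_composable kl uv'; have f6 := level_composable jl e6.
rewrite (level_compE _ e3) (level_compE _ e6) (lcompE f3) (lcompE f6).
rewrite (level_compE _ uu) (level_compE _ vv) (lcompE f1) (lcompE f2) in f3 *.
rewrite (level_compE _ uv) (level_compE _ uv') (lcompE f4) (lcompE f5) in f6 *.
exact: icomp_exchange.
Qed.

Lemma not_leq_geq j k : ~ (j <= k) -> k <= j.
Proof. by move=> /negP; rewrite -ltnNge => /ltnW. Qed.

Lemma thread_cellP k u :
  (thread_bd false k u = u) <-> (forall j, k <= j -> level u j.+1 = iid (level u j)).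
Proof.
by split=> [<- j|]; [apply: level_bd_gt|apply: thread_bd_id].
Qed.

Lemma thread_cell_eq k u v : thread_bd false k u = u -> thread_bd false k v = v ->
  level u k = level v k -> u = v.
Proof. by move=> /thread_cellP uk /thread_cellP vk; apply: thread_eq. Qed.

(** Below k the thread consists of iterated sources, above k of identities. *)
Lemma to_thread_ex k (y : Y k) : exists u, thread_bd false k u = u /\ level u k = y.
Proof.
pose yseq j : Y j := match pselect (j <= k) with
  | left le => src_iter le y
  | right nle => id_iter (@iid Y) (not_leq_geq nle) y
  end.
have yE j (le : j <= k) : yseq j = src_iter le y.
  by rewrite /yseq; case: pselect => // le'; rewrite (bool_irrelevance le le').
have yP j : j < k -> src (yseq j.+1) = yseq j.
  by move=> jk; rewrite (yE _ jk) (yE _ (ltnW jk)); apply: src_src_iter.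
exists (exist _ (pad k yseq) (padP yP)); split; last first.
  by rewrite /level /= pad_le // yE src_iter_refl.
by apply/thread_cellP => j kj; rewrite /level [LHS]pad_gt.
Qed.

Definition to_thread k (y : Y k) : thread := sval (cid (to_thread_ex y)).

Lemma to_thread_cell k (y : Y k) : thread_bd false k (to_thread y) = to_thread y.
Proof. by case: (svalP (cid (to_thread_ex y))). Qed.

Lemma level_to_thread k (y : Y k) : level (to_thread y) k = y.
Proof. by case: (svalP (cid (to_thread_ex y))). Qed.

Lemma thread_inv_ex i u : thread_bd false i.+1 u = u -> exists v,
  [/\ thread_bd false i.+1 v = v, thread_bd false i v = thread_bd true i u,
      thread_bd true i v = thread_bd false i u,
      thread_comp i v u = thread_bd false i u
    & thread_comp i u v = thread_bd true i u].
Proof.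
move=> ui; have [y [[e1 E1] [e2 E2]]] := igpd_inv (level u i.+1).
pose v := to_thread y; exists v.
have vi : thread_bd false i.+1 v = v by apply: to_thread_cell.
have vy : level v i.+1 = y by apply: level_to_thread.
have vu : thread_bd false i v = thread_bd true i u.
  apply/thread_composableP; have := e1.
  by rewrite src_iter1 tgt_iter1 -[level v i]level_src vy.
have uv : thread_bd false i u = thread_bd true i v.
  apply/thread_composableP; have := e2.
  by rewrite src_iter1 tgt_iter1 -[level u i]level_src vy.
split=> //.
  apply: (thread_cell_eq (k := i.+1)).
  - by rewrite thread_comp_bd // ui vi.
  - by rewrite thread_bd_ge.
  rewrite level_compE // vy (lcompE e1) E1 level_bd_gt // level_bd_src.
  by rewrite level_src.
apply: (thread_cell_eq (k := i.+1)).
- by rewrite thread_comp_bd // ui vi.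
- by rewrite thread_bd_ge.
by rewrite level_compE // vy (lcompE e2) E2 level_bd_gt // level_bd_tgt.
Qed.

Definition threads : ssgpd := @SSGpd thread thread_bd thread_comp
  thread_bd_lt thread_bd_ge thread_comp_src thread_comp_tgt thread_comp_bd
  thread_compA thread_comp1l thread_comp1r thread_exchange thread_inv_ex.

Program Definition from_threads_map : globular_map (cells_of threads) Y :=
  @GlobularMap (cells_of threads) Y (fun k u => level (sval u) k) _ _.
Next Obligation. exact: etrans (level_bd_src _ _) (esym (level_src _ _)). Qed.
Next Obligation. exact: level_bd_tgt. Qed.

Program Definition from_threads : infty_functor (cells_of threads) Y :=
  @InftyFunctor (cells_of threads) Y from_threads_map _ _.
Next Obligation.
rewrite level_compE; last exact: (@ss_composable threads _ _ (ltnW ltji)).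
exact: lcompE.
Qed.
Next Obligation.
by have /thread_cellP := svalP u; apply.
Qed.

Program Definition to_threads_map : globular_map Y (cells_of threads) :=
  @GlobularMap Y (cells_of threads)
    (fun k y => exist _ (to_thread y) (to_thread_cell y)) _ _.
Next Obligation.
apply: sval_inj; apply: (thread_cell_eq (k := n)).
- exact: to_thread_cell.
- exact: thread_bd_ge.
rewrite level_to_thread; apply/esym/(etrans (level_bd_src _ _)).
by rewrite -[LHS]level_src level_to_thread.
Qed.
Next Obligation.
apply: sval_inj; apply: (thread_cell_eq (k := n)).
- exact: to_thread_cell.
- exact: thread_bd_ge.
rewrite level_to_thread; apply/esym/(etrans (level_bd_tgt _ _)).
by rewrite level_to_thread.
Qed.

Program Definition to_threads : infty_functor Y (cells_of threads) :=
  @InftyFunctor Y (cells_of threads) to_threads_map _ _.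
Next Obligation.
have uv := @ss_composable threads _ _ (ltnW ltji) _ _ e'.
apply: sval_inj; apply: (thread_cell_eq (k := i)).
- exact: to_thread_cell.
- by rewrite /= thread_comp_bd // !to_thread_cell.
rewrite level_to_thread /= level_compE // (lcompE (level_composable ltji uv)).
by apply: icomp_congr; rewrite level_to_thread.
Qed.
Next Obligation.
apply: sval_inj; apply: (thread_cell_eq (k := i.+1)).
- exact: to_thread_cell.
- by apply/thread_cellP => j ij; have /thread_cellP := to_thread_cell u; apply; apply: ltnW.
rewrite level_to_thread /=.
by have /thread_cellP -> := to_thread_cell u; rewrite ?level_to_thread.
Qed.

End Thread.

(** * Path groupoids *)

Section Squares.
Variables (W : ssgpd) (n : nat).

(** The square
<<
       c
   .  --->  .
   |        |
 a |        | b
   v        v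
   .  --->  .
       d
>>
    has (n+1)-cells as vertical sides, horizontal sides of any dimension, and
    commutes for *_n. Squares form the n-th path groupoid of W: its cells below
    dimension n are those of W, its n-cells are the (n+1)-cells of W (as
    degenerate squares), and its k-cells for k > n are the squares with k-cells
    as horizontal sides. The maps to c and d are morphisms to W. *)
Record frame := Frame { fa : W; fb : W; fc : W; fd : W }.

Record is_square (w : frame) : Prop := IsSquare {
  sq_a : sbd false n.+1 (fa w) = fa w;
  sq_b : sbd false n.+1 (fb w) = fb w;
  sq_ac : sbd false n (fa w) = sbd false n (fc w);
  sq_bc : sbd false n (fb w) = sbd true n (fc w);
  sq_ad : sbd true n (fa w) = sbd false n (fd w);
  sq_bd : sbd true n (fb w) = sbd true n (fd w);
  sq_comm : scomp n (fd w) (fa w) = scomp n (fb w) (fc w) }.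

Definition square := {w | is_square w}.

Lemma square_eq (w w' : square) : fa (sval w) = fa (sval w') ->
  fb (sval w) = fb (sval w') -> fc (sval w) = fc (sval w') ->
  fd (sval w) = fd (sval w') -> w = w'.
Proof.
case: w w' => [[a b c d] wP] [[a' b' c' d'] wP'] /= *.
by apply: sval_inj => /=; congr Frame.
Qed.

(** An (n+1)-cell regarded as an n-cell of the path groupoid, and a cell below
    dimension n regarded as itself: its four sides then coincide. *)
Definition deg a := Frame a a (sbd false n a) (sbd true n a).

Lemma deg_square a : sbd false n.+1 a = a -> is_square (deg a).
Proof.
by move=> an; split; rewrite /= ?sbd_ge ?scomp1l ?scomp1r.
Qed.

Definition frame_bd (b : bool) k (w : frame) : frame :=
  if k < n then deg (sbd b k (fa w))
  else if k == n then deg (if b then fb w else fa w)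
  else Frame (fa w) (fb w) (sbd b k (fc w)) (sbd b k (fd w)).

Definition frame_comp k (w w' : frame) : frame :=
  if k < n then Frame (scomp k (fa w) (fa w')) (scomp k (fb w) (fb w'))
                      (scomp k (fc w) (fc w')) (scomp k (fd w) (fd w'))
  else if k == n then Frame (fa w') (fb w) (scomp n (fc w) (fc w')) (scomp n (fd w) (fd w'))
  else Frame (fa w) (fb w) (scomp k (fc w) (fc w')) (scomp k (fd w) (fd w')).

Section SquareFacts.
Variable w : frame.
Hypothesis wP : is_square w.

(** The sides of a square are glued along n-cells, hence agree below dimension n. *)
Lemma sq_bd_lt b k : k < n ->
  [/\ sbd b k (fb w) = sbd b k (fa w), sbd b k (fc w) = sbd b k (fa w)
    & sbd b k (fd w) = sbd b k (fa w)].
Proof.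
move=> kn; have E x (y : W) : sbd b k (sbd x n y) = sbd b k y by rewrite sbd_lt.
have Ec : sbd b k (fc w) = sbd b k (fa w) by rewrite -(E false) -(sq_ac wP) E.
split=> //.
  by rewrite -(E false (fb w)) (sq_bc wP) E.
by rewrite -(E false (fd w)) -(sq_ad wP) E.
Qed.

Lemma sq_a_id b k : n < k -> sbd b k (fa w) = fa w.
Proof. by move=> nk; apply: sbd_id nk (sq_a wP). Qed.

Lemma sq_b_id b k : n < k -> sbd b k (fb w) = fb w.
Proof. by move=> nk; apply: sbd_id nk (sq_b wP). Qed.

Lemma frame_bd_square b k : is_square (frame_bd b k w).
Proof.
rewrite /frame_bd; case: ltngtP => [kn|nk|_].
- by apply: deg_square; rewrite sbd_ge // (leqW (ltnW kn)).
- case: (wP) => a1 b1 ac bc ad bd E; split; rewrite /= ?sbd_lt //.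
  rewrite -(sq_a_id b nk) -(sq_b_id b nk) -!scomp_bd //.
  by rewrite E.
by apply: deg_square; case: wP; case: b.
Qed.

End SquareFacts.

Definition square_bd b k (w : square) : square :=
  exist _ (frame_bd b k (sval w)) (frame_bd_square (svalP w) b k).

Definition square_comp k (w w' : square) : square :=
  mk_sig w (frame_comp k (sval w) (sval w')).

Lemma square_composable_lt (w w' : square) k : k < n ->
  square_bd false k w = square_bd true k w' ->
  [/\ sbd false k (fa (sval w)) = sbd true k (fa (sval w')),
      sbd false k (fb (sval w)) = sbd true k (fb (sval w')),
      sbd false k (fc (sval w)) = sbd true k (fc (sval w'))
    & sbd false k (fd (sval w)) = sbd true k (fd (sval w'))].
Proof.
move=> kn /(congr1 (@sval _ _)); rewrite /= /frame_bd kn => -[E _ _ _].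
have [-> -> ->] := sq_bd_lt (svalP w) false kn.
by have [-> -> ->] := sq_bd_lt (svalP w') true kn.
Qed.

Lemma square_composable_eq (w w' : square) :
  square_bd false n w = square_bd true n w' ->
  [/\ fa (sval w) = fb (sval w'),
      sbd false n (fc (sval w)) = sbd true n (fc (sval w'))
    & sbd false n (fd (sval w)) = sbd true n (fd (sval w'))].
Proof.
move=> /(congr1 (@sval _ _)); rewrite /= /frame_bd ltnn eqxx => -[E _ _].
by rewrite -(sq_ac (svalP w)) -(sq_ad (svalP w)) E (sq_bc (svalP w')) (sq_bd (svalP w')).
Qed.

Lemma square_composable_gt (w w' : square) k : n < k ->
  square_bd false k w = square_bd true k w' ->
  [/\ fa (sval w) = fa (sval w'), fb (sval w) = fb (sval w'),
      sbd false k (fc (sval w)) = sbd true k (fc (sval w'))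
    & sbd false k (fd (sval w)) = sbd true k (fd (sval w'))].
Proof.
move=> nk /(congr1 (@sval _ _)); rewrite /= /frame_bd ltnNge (ltnW nk) /=.
by rewrite (gtn_eqF nk) => -[].
Qed.

(** The composite square commutes by exchange if k differs from n (the shared
    vertical sides being their own *_k-composites if k > n), and by associativity
    if k = n. *)
Lemma frame_comp_square (w w' : square) k :
  square_bd false k w = square_bd true k w' -> is_square (frame_comp k (sval w) (sval w')).
Proof.
move=> ww'; rewrite /frame_comp; case: ltngtP => [kn|nk|E].
- have [ea eb ec ed] := square_composable_lt kn ww'.
  have kn1 : k < n.+1 by apply: ltnW.
  case: (svalP w) (svalP w') => [a1 b1 ac1 bc1 ad1 bd1 E1] [a2 b2 ac2 bc2 ad2 bd2 E2].
  split; rewrite /= ?scomp_bd ?ac1 ?bc1 ?ad1 ?bd1 ?ac2 ?bc2 ?ad2 ?bd2 ?a1 ?a2 ?b1 ?b2 //.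
  by rewrite -scomp_exchange // -[RHS]scomp_exchange // E1 E2.
- have [ea eb ec ed] := square_composable_gt nk ww'.
  case: (svalP w) (svalP w') => [a1 b1 ac1 bc1 ad1 bd1 E1] [a2 b2 ac2 bc2 ad2 bd2 E2].
  split; rewrite /= ?(scomp_bd_lt _ nk) // ?ea ?eb //.
  have ak b0 := sq_a_id (svalP w') b0 nk; have bk b0 := sq_b_id (svalP w') b0 nk.
  rewrite -(scomp_diag (ak false)) -(scomp_diag (bk false)).
  rewrite [LHS](scomp_exchange nk ed) ?ak // -?ea -?ad1 //.
  rewrite [RHS](scomp_exchange nk _ ec) ?bk // -?eb //.
  by rewrite E1 ea eb E2.
subst k; have [E cc dd] := square_composable_eq ww'.
case: (svalP w) (svalP w') => [a1 b1 ac1 bc1 ad1 bd1 E1] [a2 b2 ac2 bc2 ad2 bd2 E2].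
split; rewrite /= ?scomp_src ?scomp_tgt //.
by rewrite scompA // E2 -E -[LHS]scompA // ?E1 ?scompA // E.
Qed.

Lemma sval_square_comp (w w' : square) k :
  square_bd false k w = square_bd true k w' ->
  sval (square_comp k w w') = frame_comp k (sval w) (sval w').
Proof. by move=> ww'; rewrite sval_mk_sig //; apply: frame_comp_square. Qed.

Lemma frame_bd_deg b k a : n <= k -> frame_bd b k (deg a) = deg a.
Proof.
rewrite /frame_bd leq_eqVlt => /orP[/eqP <-|nk]; first by rewrite ltnn eqxx if_same.
by rewrite ltnNge (ltnW nk) (gtn_eqF nk) /= !sbd_ge // ltnW.
Qed.

Lemma square_bd_lt b b' i j w :
  i < j -> square_bd b i (square_bd b' j w) = square_bd b i w.
Proof.
move=> ij; apply: sval_inj; rewrite /= {1 3}/frame_bd.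
case: ltngtP => [lt|gt|E].
- rewrite {1}/frame_bd; case: ltngtP => //= *; first by rewrite sbd_lt.
  by case: b' => //; have [-> _ _] := sq_bd_lt (svalP w) b lt.
- have jn := ltn_trans gt ij.
  by rewrite /frame_bd ltnNge (ltnW jn) (gtn_eqF jn) /= !sbd_lt.
by subst i; rewrite /frame_bd ltnNge (ltnW ij) (gtn_eqF ij).
Qed.

Lemma square_bd_ge b b' i j w :
  j <= i -> square_bd b i (square_bd b' j w) = square_bd b' j w.
Proof.
move=> ji; apply: sval_inj; rewrite /= [frame_bd b' j _]/frame_bd.
case: ltngtP => [jn|nj|jn].
- case: (leqP n i) => [ni|i_n]; first exact: frame_bd_deg.
  by rewrite /frame_bd i_n /= sbd_ge.
- have ni := leq_trans nj ji.
  by rewrite /frame_bd ltnNge (ltnW ni) (gtn_eqF ni) /= !sbd_ge.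
by apply: frame_bd_deg; rewrite -jn.
Qed.

Lemma frame_comp_deg k a a' : k < n -> sbd false k a = sbd true k a' ->
  frame_comp k (deg a) (deg a') = deg (scomp k a a').
Proof. by move=> kn aa; rewrite /frame_comp kn /deg !scomp_bd. Qed.

Lemma square_comp_src k w w' : square_bd false k w = square_bd true k w' ->
  square_bd false k (square_comp k w w') = square_bd false k w'.
Proof.
move=> ww'; apply: sval_inj; rewrite /= sval_square_comp // /frame_bd /frame_comp.
case: ltngtP => //= lt.
  by have [ea _ _ _] := square_composable_lt lt ww'; rewrite scomp_src.
by have [-> -> ec ed] := square_composable_gt lt ww'; rewrite !scomp_src.
Qed.

Lemma square_comp_tgt k w w' : square_bd false k w = square_bd true k w' ->
  square_bd true k (square_comp k w w') = square_bd true k w.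
Proof.
move=> ww'; apply: sval_inj; rewrite /= sval_square_comp // /frame_bd /frame_comp.
case: ltngtP => //= lt.
  by have [ea _ _ _] := square_composable_lt lt ww'; rewrite scomp_tgt.
by have [_ _ ec ed] := square_composable_gt lt ww'; rewrite !scomp_tgt.
Qed.

Lemma square_comp_bd b i j w w' : j < i -> square_bd false j w = square_bd true j w' ->
  square_bd b i (square_comp j w w')
  = square_comp j (square_bd b i w) (square_bd b i w').
Proof.
move=> ji ww'.
have ww'' : square_bd false j (square_bd b i w) = square_bd true j (square_bd b i w').
  by rewrite !square_bd_lt.
apply: sval_inj; rewrite sval_square_comp // /= sval_square_comp //.
case: (ltngtP j n) => lt.
- have [ea eb ec ed] := square_composable_lt lt ww'.
  rewrite /frame_bd; case: ltngtP => lt'.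
  + by rewrite frame_comp_deg ?sbd_lt // /frame_comp lt /= scomp_bd.
  + by rewrite /frame_comp lt /= !scomp_bd.
  by case: b {ww''}; rewrite frame_comp_deg // /frame_comp lt.
- have ni := ltn_trans lt ji.
  have [ea eb ec ed] := square_composable_gt lt ww'.
  rewrite /frame_bd /frame_comp !(ltnNge _ n) (ltnW ni) (ltnW lt) /=.
  by rewrite (gtn_eqF ni) (gtn_eqF lt) /= !scomp_bd.
subst j; have [E cc dd] := square_composable_eq ww'.
rewrite /frame_bd /frame_comp ltnn eqxx (ltnNge i) (ltnW ji) (gtn_eqF ji) /=.
by rewrite !scomp_bd.
Qed.

Lemma square_compA k u v w :
  square_bd false k u = square_bd true k v ->
  square_bd false k v = square_bd true k w ->
  square_comp k (square_comp k u v) w = square_comp k u (square_comp k v w).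
Proof.
move=> uv vw; apply: sval_inj.
rewrite sval_square_comp ?square_comp_src // sval_square_comp //.
rewrite sval_square_comp ?square_comp_tgt // sval_square_comp //.
rewrite /frame_comp; case: ltngtP => lt /=.
- have [? ? ? ?] := square_composable_lt lt uv.
  by have [? ? ? ?] := square_composable_lt lt vw; rewrite !scompA.
- have [? ? ? ?] := square_composable_gt lt uv.
  by have [? ? ? ?] := square_composable_gt lt vw; rewrite !scompA.
subst k.
have [_ ? ?] := square_composable_eq uv.
by have [_ ? ?] := square_composable_eq vw; rewrite !scompA.
Qed.

Lemma square_comp1l k u : square_comp k (square_bd true k u) u = u.
Proof.
have E : square_bd false k (square_bd true k u) = square_bd true k u.
  exact: square_bd_ge.
apply: square_eq; rewrite (sval_square_comp E) /= /frame_bd /frame_comp;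
  case: ltngtP => lt //=.
all: rewrite ?(sbd_ge _ _ _ (ltnW lt)) ?scomp1l //.
- by have [<- _ _] := sq_bd_lt (svalP u) true lt; rewrite scomp1l.
- by have [_ <- _] := sq_bd_lt (svalP u) true lt; rewrite scomp1l.
- by rewrite (sq_bc (svalP u)) scomp1l.
- by have [_ _ <-] := sq_bd_lt (svalP u) true lt; rewrite scomp1l.
by rewrite (sq_bd (svalP u)) scomp1l.
Qed.

Lemma square_comp1r k u : square_comp k u (square_bd false k u) = u.
Proof.
have E : square_bd false k u = square_bd true k (square_bd false k u).
  exact/esym/square_bd_ge.
apply: square_eq; rewrite (sval_square_comp E) /= /frame_bd /frame_comp;
  case: ltngtP => lt //=.
all: rewrite ?(sbd_ge _ _ _ (ltnW lt)) ?scomp1r //.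
- by have [<- _ _] := sq_bd_lt (svalP u) false lt; rewrite scomp1r.
- by have [_ <- _] := sq_bd_lt (svalP u) false lt; rewrite scomp1r.
- by rewrite (sq_ac (svalP u)) scomp1r.
- by have [_ _ <-] := sq_bd_lt (svalP u) false lt; rewrite scomp1r.
by rewrite (sq_ad (svalP u)) scomp1r.
Qed.

Lemma square_exchange j k u u' v v' : k < j ->
  square_bd false j u = square_bd true j u' ->
  square_bd false j v = square_bd true j v' ->
  square_bd false k u = square_bd true k v ->
  square_comp k (square_comp j u u') (square_comp j v v')
  = square_comp j (square_comp k u v) (square_comp k u' v').
Proof.
move=> kj uu vv uv.
have lt1 b j' x y : square_bd false j x = square_bd true j y -> j' < j ->
    square_bd b j' x = square_bd b j' y.
  by move=> xy lt; rewrite -(square_bd_lt b false x lt) xy square_bd_lt.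
have uv' : square_bd false k u' = square_bd true k v'.
  by rewrite -(lt1 _ _ _ _ uu kj) -(lt1 _ _ _ _ vv kj).
have e3 : square_bd false k (square_comp j u u') = square_bd true k (square_comp j v v').
  rewrite -(square_bd_lt false false _ kj) -(square_bd_lt true false (square_comp j v v') kj).
  by rewrite !square_comp_src // !square_bd_lt.
have e6 : square_bd false j (square_comp k u v) = square_bd true j (square_comp k u' v').
  by rewrite !square_comp_bd // uu vv.
apply: sval_inj; rewrite (sval_square_comp e3) (sval_square_comp e6).
rewrite (sval_square_comp uu) (sval_square_comp vv) (sval_square_comp uv).
rewrite (sval_square_comp uv').
case: (ltngtP j n) => [jn|nj|jn].
- have kn := ltn_trans kj jn; rewrite /frame_comp jn kn /=.
  have [a1 b1 c1 d1] := square_composable_lt jn uu.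
  have [a2 b2 c2 d2] := square_composable_lt jn vv.
  have [a3 b3 c3 d3] := square_composable_lt kn uv.
  by congr Frame; apply: scomp_exchange.
- have [_ _ c1 d1] := square_composable_gt nj uu.
  have [_ _ c2 d2] := square_composable_gt nj vv.
  rewrite /frame_comp (ltnNge j) (ltnW nj) (gtn_eqF nj) /=.
  case: (ltngtP k n) => [kn|nk|kn] /=.
  + have [a3 b3 c3 d3] := square_composable_lt kn uv.
    by congr Frame; apply: scomp_exchange.
  + have [a3 b3 c3 d3] := square_composable_gt nk uv.
    by congr Frame; apply: scomp_exchange.
  subst k; have [_ c3 d3] := square_composable_eq uv.
  by congr Frame; apply: scomp_exchange.
subst j; rewrite /frame_comp ltnn eqxx kj /=.
have [_ c1 d1] := square_composable_eq uu.
have [_ c2 d2] := square_composable_eq vv.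
have [a3 b3 c3 d3] := square_composable_lt kj uv.
by congr Frame; apply: scomp_exchange.
Qed.

(** The vertical side b is invertible, so that c = b^-1 *_n d *_n a. *)
Lemma square_eq_d (w w' : square) : fa (sval w) = fa (sval w') ->
  fb (sval w) = fb (sval w') -> fd (sval w) = fd (sval w') -> w = w'.
Proof.
move=> ea eb ed; apply: square_eq => //; apply: (scomp_cancel (sq_b (svalP w))).
- exact: sq_bc (svalP w).
- by rewrite eb; apply: sq_bc (svalP w').
by rewrite -(sq_comm (svalP w)) ea ed (sq_comm (svalP w')) eb.
Qed.

(** Again c = b^-1 *_n d *_n a. With [square_eq_d], squares over a, b correspond
    to their lower side. *)
Lemma square_ex_d (a b d : W) :
  sbd false n.+1 a = a -> sbd false n.+1 b = b ->
  sbd true n a = sbd false n d -> sbd true n b = sbd true n d ->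
  exists w : square, [/\ fa (sval w) = a, fb (sval w) = b & fd (sval w) = d].
Proof.
move=> an bn ad bd.
have [|c [tc sc E]] := scomp_solve (c := scomp n d a) bn.
  by rewrite scomp_tgt.
have wP : is_square (Frame a b c d).
  by split=> //=; rewrite sc scomp_src.
by exists (exist _ _ wP).
Qed.

Lemma square_cell_le k (w : square) : k <= n -> square_bd false k w = w ->
  sval w = deg (fa (sval w)) /\ (k < n -> sbd false k (fa (sval w)) = fa (sval w)).
Proof.
rewrite leq_eqVlt => /orP[/eqP ->|kn] /(congr1 (@sval _ _)); rewrite /= /frame_bd.
  by rewrite ltnn eqxx; case: (sval w) => a b c d /= [<- <- <-].
by rewrite kn; case: (sval w) => a b c d /= [E <- <- <-]; rewrite !E.
Qed.

Lemma square_cell_d k (w : square) : n < k -> sbd false k (fd (sval w)) = fd (sval w) ->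
  square_bd false k w = w.
Proof.
by move=> nk dk; apply: square_eq_d;
  rewrite /= /frame_bd ltnNge (ltnW nk) /= (gtn_eqF nk).
Qed.

Lemma square_cell_gt k (w : square) : n < k -> square_bd false k w = w ->
  sbd false k (fd (sval w)) = fd (sval w).
Proof.
move=> nk /(congr1 (@sval _ _)); rewrite /= /frame_bd ltnNge (ltnW nk) /=.
by rewrite (gtn_eqF nk); case: (sval w) => a b c d /= [_ ->].
Qed.

(** Below n, invert the (n+1)-cell underlying a degenerate square, which for
    i = n - 1 is two dimensions above *_i. From n on, invert the lower side, the
    vertical sides being kept (n < i) or swapped (i = n); the upper side
    follows. *)
Lemma square_inv_ex i (u : square) : square_bd false i.+1 u = u -> exists v,
  [/\ square_bd false i.+1 v = v, square_bd false i v = square_bd true i u,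
      square_bd true i v = square_bd false i u,
      square_comp i v u = square_bd false i u
    & square_comp i u v = square_bd true i u].
Proof.
have bd_gt b k (w : square) : n < k ->
    [/\ fa (sval (square_bd b k w)) = fa (sval w),
        fb (sval (square_bd b k w)) = fb (sval w)
      & fd (sval (square_bd b k w)) = sbd b k (fd (sval w))].
  by move=> nk; rewrite /= /frame_bd ltnNge (ltnW nk) /= (gtn_eqF nk).
have bd_n b (w : square) :
    sval (square_bd b n w) = deg (if b then fb (sval w) else fa (sval w)).
  by rewrite /= /frame_bd ltnn eqxx.
move=> ui; case: (ltngtP i n) => [lt|nk|E].
- have [uE ua] := square_cell_le lt ui.
  pose a := fa (sval u); rewrite -/a in uE ua.
  have [a' [[a'n a'i] sa' ta' a'a aa']] : exists a' : W,
      [/\ sbd false n.+1 a' = a' /\ (i.+1 < n -> sbd false i.+1 a' = a'),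
        sbd false i a' = sbd true i a,
        sbd true i a' = sbd false i a, scomp i a' a = sbd false i a
      & scomp i a a' = sbd true i a].
    have := lt; rewrite leq_eqVlt => /orP[/eqP E|lt'].
      have aE := sq_a (svalP u); rewrite -E in aE.
      have [a' [a'1 ? ? ? ?]] := sinv2_ex aE.
      by exists a'; split=> //; rewrite -E ltnn.
    have [a' [a'1 ? ? ? ?]] := sinv_ex (ua lt').
    by exists a'; split=> //; split=> //; apply: sbd_id a'1; apply: ltnW.
  pose v : square := exist _ (deg a') (deg_square a'n).
  have vu : square_bd false i v = square_bd true i u.
    by apply: sval_inj; rewrite /= uE /frame_bd lt /= sa'.
  have uv : square_bd true i v = square_bd false i u.
    by apply: sval_inj; rewrite /= uE /frame_bd lt /= ta'.
  exists v; split=> //; apply: sval_inj.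
  + have := lt; rewrite leq_eqVlt => /orP[/eqP E|lt'].
      by rewrite /= frame_bd_deg // E.
    by rewrite /= /frame_bd lt' /= a'i.
  + by rewrite sval_square_comp // uE frame_comp_deg // a'a /= uE /frame_bd lt.
  by rewrite sval_square_comp // uE frame_comp_deg // ?aa' //= uE /frame_bd lt.
- have ni : n < i.+1 by apply: ltnW.
  have [d' [d'1 sd' td' d'd dd']] := sinv_ex (square_cell_gt ni ui).
  have [| |v [va vb vd]] := square_ex_d (d := d') (sq_a (svalP u)) (sq_b (svalP u)).
  + by rewrite (sq_ad (svalP u)) -(composable_lt _ nk (esym td')).
  + by rewrite (sq_bd (svalP u)) -(composable_lt _ nk (esym td')).
  have bdE b (w : square) := bd_gt b _ w nk.
  have vu : square_bd false i v = square_bd true i u.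
    have [e1 e2 e3] := bdE false v; have [f1 f2 f3] := bdE true u.
    by apply: square_eq_d; rewrite ?e1 ?e2 ?e3 ?f1 ?f2 ?f3 ?vd.
  have uv : square_bd true i v = square_bd false i u.
    have [e1 e2 e3] := bdE true v; have [f1 f2 f3] := bdE false u.
    by apply: square_eq_d; rewrite ?e1 ?e2 ?e3 ?f1 ?f2 ?f3 ?vd.
  have gt : (i < n) = false by rewrite ltnNge (ltnW nk).
  have neq := gtn_eqF nk.
  exists v; split=> //; first by apply: square_cell_d; rewrite // vd.
  + have [f1 f2 f3] := bdE false u.
    by apply: square_eq_d; rewrite ?f1 ?f2 ?f3 (sval_square_comp vu) /frame_comp gt neq //= vd.
  have [f1 f2 f3] := bdE true u.
  by apply: square_eq_d; rewrite ?f1 ?f2 ?f3 (sval_square_comp (esym uv)) /frame_comp gt neq //= vd.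
subst i.
have [d' [d'1 sd' td' d'd dd']] := sinv_ex (square_cell_gt (ltnSn n) ui).
have [| |v [va vb vd]] := square_ex_d (d := d') (sq_b (svalP u)) (sq_a (svalP u)).
- by rewrite (sq_bd (svalP u)).
- by rewrite (sq_ad (svalP u)).
have vu : square_bd false n v = square_bd true n u.
  by apply: sval_inj; rewrite !bd_n va.
have uv : square_bd true n v = square_bd false n u.
  by apply: sval_inj; rewrite !bd_n vb.
exists v; split=> //; first by apply: square_cell_d; rewrite // vd.
- apply: square_eq_d; rewrite bd_n (sval_square_comp vu) /frame_comp ltnn eqxx //=.
  by rewrite vd d'd (sq_ad (svalP u)).
apply: square_eq_d; rewrite bd_n (sval_square_comp (esym uv)) /frame_comp ltnn eqxx //=.
by rewrite vd dd' (sq_bd (svalP u)).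
Qed.

Definition squares : ssgpd := @SSGpd square square_bd square_comp
  square_bd_lt square_bd_ge square_comp_src square_comp_tgt square_comp_bd
  square_compA square_comp1l square_comp1r square_exchange square_inv_ex.

End Squares.

(** * Paths between cells *)

Section SquareMaps.
Variables (W : ssgpd) (n : nat).
Implicit Types w : squares W n.

Lemma square_const_subproof (x : W) :
  is_square n (Frame (sbd false n x) (sbd true n x) x x).
Proof. by split; rewrite /= ?sbd_ge ?scomp1l ?scomp1r. Qed.

(** Constant paths; the vertical sides are the identities at both ends of x. *)
Definition square_const (x : W) : squares W n :=
  exist _ _ (square_const_subproof x).

Program Definition square_const_mor : ss_mor W (squares W n) :=
  @SSMor W (squares W n) square_const _ _.
Next Obligation.
apply: sval_inj; rewrite /= /frame_bd /=; case: ltngtP => [kn|nk|->].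
- by rewrite /deg (sbd_lt _ _ _ kn) !(sbd_ge _ _ _ (ltnW kn)).
- by rewrite !(sbd_lt _ _ _ nk).
by rewrite /deg; case: b; rewrite !sbd_ge.
Qed.
Next Obligation.
have uv : square_bd false k (square_const u) = square_bd true k (square_const v).
  apply: sval_inj; rewrite /= /frame_bd /=; case: ltngtP => [kn|nk|E].
  - by rewrite !sbd_lt // H.
  - by rewrite H !(composable_lt _ nk H).
  by subst k; rewrite H.
apply: sval_inj; rewrite sval_square_comp // /frame_comp /=.
case: ltngtP => [kn|nk|E].
- by rewrite !scomp_bd.
- by rewrite !(scomp_bd_lt _ nk H) !(composable_lt _ nk H).
by subst k; rewrite scomp_src // scomp_tgt.
Qed.

Lemma fc_frame_bd b k w : fc (frame_bd n b k (sval w)) = sbd b k (fc (sval w)).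
Proof.
rewrite /frame_bd; case: ltngtP => [kn|nk|->] //=.
  have [_ -> _] := sq_bd_lt (svalP w) b kn.
  by rewrite sbd_ge // ltnW.
by case: b => /=; rewrite ?(sq_ac (svalP w)) ?(sq_bc (svalP w)).
Qed.

Lemma fd_frame_bd b k w : fd (frame_bd n b k (sval w)) = sbd b k (fd (sval w)).
Proof.
rewrite /frame_bd; case: ltngtP => [kn|nk|->] //=.
  have [_ _ ->] := sq_bd_lt (svalP w) b kn.
  by rewrite sbd_ge // ltnW.
by case: b => /=; rewrite ?(sq_ad (svalP w)) ?(sq_bd (svalP w)).
Qed.

Lemma fc_frame_comp k (w w' : frame W) :
  fc (frame_comp n k w w') = scomp k (fc w) (fc w').
Proof. by rewrite /frame_comp; case: ltngtP => [kn|nk|->]. Qed.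

Lemma fd_frame_comp k (w w' : frame W) :
  fd (frame_comp n k w w') = scomp k (fd w) (fd w').
Proof. by rewrite /frame_comp; case: ltngtP => [kn|nk|->]. Qed.

Program Definition square_c : ss_mor (squares W n) W :=
  @SSMor (squares W n) W (fun w => fc (sval w)) _ _.
Next Obligation. exact: fc_frame_bd. Qed.
Next Obligation. by rewrite sval_square_comp ?fc_frame_comp //; apply: sval_inj. Qed.

Program Definition square_d : ss_mor (squares W n) W :=
  @SSMor (squares W n) W (fun w => fd (sval w)) _ _.
Next Obligation. exact: fd_frame_bd. Qed.
Next Obligation. by rewrite sval_square_comp ?fd_frame_comp //; apply: sval_inj. Qed.

Lemma square_d_cell k w : sbd false k w = w -> sbd false k (fd (sval w)) = fd (sval w).
Proof.
move=> wk; rewrite -(fd_frame_bd _ _ w).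
exact: (congr1 (fun v : squares W n => fd (sval v)) wk).
Qed.

Lemma square_cell_lt k w : k < n -> sbd false k w = w -> fc (sval w) = fd (sval w).
Proof.
move=> kn wk; have [-> ak] := square_cell_le (ltnW kn) wk.
by rewrite -(ak kn) /= !sbd_ge // ltnW.
Qed.

(** Parallel k-cells with k > n share their vertical sides. *)
Lemma square_cell_uniq k w w' : n < k ->
  (forall b j, j < k -> sbd b j w = sbd b j w') -> fd (sval w) = fd (sval w') ->
  w = w'.
Proof.
move=> nk /(_ _ n nk) E dd; apply: square_eq_d => //.
  have := congr1 (@sval _ _) (E false).
  by rewrite /= /frame_bd ltnn eqxx => -[].
have := congr1 (@sval _ _) (E true).
by rewrite /= /frame_bd ltnn eqxx => -[].
Qed.

(** A cell h between the lower sides of two parallel squares lifts to a cell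
    between the squares: its vertical sides are those at the ends of h, namely
    the common ones if k > n, and the (n+1)-cells underlying w and w' if k = n. *)
Lemma square_cell_lift k w w' (h : W) : n <= k ->
  sbd false k w = w -> sbd false k w' = w' ->
  (forall b j, j < k -> sbd b j w = sbd b j w') ->
  sbd false k.+1 h = h -> sbd false k h = fd (sval w) -> sbd true k h = fd (sval w') ->
  exists v : squares W n,
    [/\ sbd false k.+1 v = v, sbd false k v = w, sbd true k v = w' & fd (sval v) = h].
Proof.
rewrite leq_eqVlt => /orP[/eqP <- {k} wn wn' ww' hn sh th|nk wk wk' ww' hk sh th].
  have [wE _] := square_cell_le (leqnn n) wn.
  have [wE' _] := square_cell_le (leqnn n) wn'.
  have [| |v [va vb vd]] := square_ex_d (d := h) (sq_a (svalP w)) (sq_a (svalP w')).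
  - by rewrite sh (sq_ad (svalP w)) square_d_cell.
  - by rewrite th wE'.
  exists v; split=> //; first by apply: square_cell_d; rewrite ?vd.
    by apply: sval_inj; rewrite /= /frame_bd ltnn eqxx va wE.
  by apply: sval_inj; rewrite /= /frame_bd ltnn eqxx vb wE'.
have [ea eb] : fa (sval w) = fa (sval w') /\ fb (sval w) = fb (sval w').
  have := congr1 (@sval _ _) (ww' false n nk).
  have := congr1 (@sval _ _) (ww' true n nk).
  by rewrite /= /frame_bd ltnn eqxx => -[-> _ _ _] -[-> _ _ _].
have [| |v [va vb vd]] := square_ex_d (d := h) (sq_a (svalP w)) (sq_b (svalP w)).
- by rewrite (sq_ad (svalP w)) -sh sbd_lt.
- by rewrite (sq_bd (svalP w)) -sh sbd_lt.
exists v; split=> //; first by apply: square_cell_d; rewrite ?vd // ltnW.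
  by apply: square_eq_d; rewrite /= /frame_bd ltnNge (ltnW nk) (gtn_eqF nk) //= vd.
by apply: square_eq_d; rewrite /= /frame_bd ltnNge (ltnW nk) (gtn_eqF nk) //= ?vd ?va ?vb.
Qed.

End SquareMaps.

(** * Free expansions of groupoids *)

Definition parallel (X : globular_set) n : X n -> X n -> Prop :=
  match n with
  | 0 => fun _ _ => True
  | m.+1 => fun f g => src f = src g /\ tgt f = tgt g
  end.

Lemma parallel_map (X Y : globular_set) (f : globular_map X Y) n (x y : X n) :
  parallel x y -> parallel (f n x) (f n y).
Proof. by case: n x y => //= n x y [s t]; rewrite -!gfun_src -!gfun_tgt s t. Qed.

Definition acyclic (X : globular_set) : Prop := forall n (f g : X n),
  parallel f g -> exists h : X n.+1, src h = f /\ tgt h = g.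

Definition thin (X : globular_set) n : Prop :=
  forall f g : X n, parallel f g -> f = g.

Lemma parallel_ss_bd (W : ssgpd) k (x y : cells_of W k) : parallel x y ->
  forall b j, j < k -> sbd b j (sval x) = sbd b j (sval y).
Proof.
case: k x y => // k x y [/(congr1 (@sval _ _)) s /(congr1 (@sval _ _)) t] b j.
rewrite ltnS leq_eqVlt => /orP[/eqP ->|jk]; first by case: b.
rewrite -(sbd_lt b false (sval x) jk) -(sbd_lt b false (sval y) jk).
by congr (sbd b j _); exact: s.
Qed.

(** X' is the pushout of x : D_n -> X along the target inclusion D_n -> D_(n+1),
    z being the new (n+1)-cell: a morphism out of X' amounts to a morphism f out
    of X and a cell with target f x. *)
Definition freely_expands (X X' : infty_groupoid) (i : infty_functor X X')
    n (x : X n) (z : X' n.+1) : Prop :=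
  forall (Y : infty_groupoid) (f : infty_functor X Y) (y : Y n.+1),
    tgt y = f n x ->
  exists g : infty_functor X' Y,
    [/\ infty_functor_comp g i = f, g n.+1 z = y
      & forall g', infty_functor_comp g' i = f -> g' n.+1 z = y -> g' = g].

Section Expansion.
Variables (X X' : infty_groupoid) (i : infty_functor X X').
Variables (n : nat) (x : X n) (z : X' n.+1).
Hypotheses (zx : tgt z = i n x) (iz : freely_expands i x z).

Lemma expansion_ext (Y : infty_groupoid) (g g' : infty_functor X' Y) :
  infty_functor_comp g i = infty_functor_comp g' i -> g n.+1 z = g' n.+1 z -> g = g'.
Proof.
move=> gi gz.
have [|h [_ _ hU]] := iz (f := infty_functor_comp g' i) (y := g' n.+1 z).
  by rewrite -gfun_tgt zx.
by rewrite (hU g) // (hU g').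
Qed.

Let S : ssgpd := threads X'.
Let Q : infty_groupoid := cells_of (squares S n).
Let prc : infty_functor Q X' :=
  infty_functor_comp (from_threads X') (cells_map (square_c S n)).
Let prd : infty_functor Q X' :=
  infty_functor_comp (from_threads X') (cells_map (square_d S n)).
Let const : infty_functor X' Q :=
  infty_functor_comp (cells_map (square_const_mor S n)) (to_threads X').

(** The retraction r sends z to the identity of x, and eta is a homotopy from the
    identity of X' to i r that is constant on X and given by z itself on z. It
    exists because squares form a groupoid, so that the universal property of X'
    applies to it. *)
Lemma expansion_homotopy : exists (r : infty_functor X' X) (eta : infty_functor X' Q),
  [/\ infty_functor_comp prc eta = infty_functor_id X'
    & infty_functor_comp prd eta = infty_functor_comp i r].
Proof.
have [|r [ri rz _]] := iz (f := infty_functor_id X) (y := iid x).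
  by rewrite iid_tgt.
pose t : S := to_thread z; pose s : S := sbd true n t.
have t1 : sbd false n.+1 t = t by apply: to_thread_cell.
have s1 : sbd false n.+1 s = s by rewrite sbd_ge.
have s0 : sbd false n s = s by apply: sbd_ge.
have st : sbd true n s = s by apply: sbd_ge.
(* the image of z: a path from z to the identity of x along z *)
have qP : is_square n (Frame t s t s).
  by split=> //; exact: esym s0.
pose q : squares S n := exist _ _ qP.
have q1 : sbd false n.+1 q = q.
  exact: (@square_cell_d _ _ _ q (ltnSn n) s1).
have sE : s = to_thread (i n x).
  apply: (thread_cell_eq (k := n)).
  - exact: thread_bd_ge.
  - exact: to_thread_cell.
  by rewrite level_bd_tgt !level_to_thread.
have [|eta [etai etaz _]] := iz (f := infty_functor_comp const i)
    (y := (exist _ q q1 : Q n.+1)).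
  apply: sval_inj; apply: sval_inj.
  rewrite /= /frame_bd ltnn eqxx /= -sE /deg.
  by rewrite -[thread_bd false n s]/(sbd false n s) -[thread_bd true n s]/(sbd true n s) s0 st.
exists r, eta; split; apply: expansion_ext.
- apply/infty_functor_ext/globular_map_ext => k y /=.
  have -> : eta k (i k y) = infty_functor_comp eta i k y by [].
  by rewrite etai /= level_to_thread.
- by rewrite /= etaz /= level_to_thread.
- apply/infty_functor_ext/globular_map_ext => k y /=.
  have -> : eta k (i k y) = infty_functor_comp eta i k y by [].
  have -> : r k (i k y) = infty_functor_comp r i k y by [].
  by rewrite etai ri /= level_to_thread.
rewrite /= etaz rz ifun_id -zx; apply: etrans (level_bd_gt true t (leqnn n)) _.
by rewrite level_bd_tgt level_to_thread.
Qed.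

(** Given parallel f, g, a filler of r f, r g in X is mapped by i to a filler of
    i r f, i r g. Below dimension n, the homotopy is trivial and i r f = f. From
    dimension n on, the filler is carried along the homotopy by
    [square_cell_lift], and its upper side fills f, g. *)
Theorem acyclic_expansion : acyclic X -> acyclic X'.
Proof.
move=> Xa k f g fg; have [r [eta [cE dE]]] := expansion_homotopy.
have c_ j (y : X' j) : level (fc (sval (sval (eta j y)))) j = y.
  exact: (congr1 (fun h : infty_functor _ _ => h j y) cE).
have d_ j (y : X' j) : level (fd (sval (sval (eta j y)))) j = i j (r j y).
  exact: (congr1 (fun h : infty_functor _ _ => h j y) dE).
have [h [sh th]] := Xa k _ _ (parallel_map r fg).
case: (ltnP k n) => [kn|nk].
  have E (y : X' k) : i k (r k y) = y.
    by rewrite -d_ -(square_cell_lt kn (svalP (eta k y))) c_.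
  by exists (i k.+1 h); rewrite -gfun_src -gfun_tgt sh th !E.
pose t := to_thread (i k.+1 h).
have t1 : sbd false k.+1 (t : S) = t by apply: to_thread_cell.
have dk (y : X' k) : sbd false k (fd (sval (sval (eta k y)))) = fd (sval (sval (eta k y))).
  exact: square_d_cell (svalP (eta k y)).
have st : sbd false k (t : S) = fd (sval (sval (eta k f))).
  apply: (thread_cell_eq (k := k)); [exact: thread_bd_ge|exact: dk|].
  by rewrite d_ level_bd_src -level_src level_to_thread -gfun_src sh.
have tt : sbd true k (t : S) = fd (sval (sval (eta k g))).
  apply: (thread_cell_eq (k := k)); [exact: thread_bd_ge|exact: dk|].
  by rewrite d_ level_bd_tgt level_to_thread -gfun_tgt th.
have [v [v1 sv tv vd]] := square_cell_lift nk (svalP (eta k f)) (svalP (eta k g))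
  (parallel_ss_bd (parallel_map eta fg)) t1 st tt.
pose v' : Q k.+1 := exist _ v v1.
exists (prc k.+1 v'); rewrite -gfun_src -gfun_tgt.
have -> : src v' = eta k f by apply: sval_inj.
have -> : tgt v' = eta k g by apply: sval_inj.
by rewrite /= !c_.
Qed.

(** For parallel m-cells f, g with m > n, the squares eta f, eta g are parallel
    and their lower sides i r f = i r g agree, so they are equal by
    [square_cell_uniq], and so are their upper sides f and g. *)
Theorem thin_expansion m : n < m -> thin X m -> thin X' m.
Proof.
move=> nm Xt f g fg; have [r [eta [cE dE]]] := expansion_homotopy.
suff E : eta m f = eta m g.
  rewrite -[f]/(infty_functor_id X' m f) -[g]/(infty_functor_id X' m g) -cE.
  by rewrite /= E.
have d_ j (y : X' j) : level (fd (sval (sval (eta j y)))) j = i j (r j y).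
  exact: (congr1 (fun h : infty_functor _ _ => h j y) dE).
have dm (y : X' m) : sbd false m (fd (sval (sval (eta m y)))) = fd (sval (sval (eta m y))).
  exact: square_d_cell (svalP (eta m y)).
apply: sval_inj; apply: (square_cell_uniq nm).
  exact: parallel_ss_bd (parallel_map eta fg).
apply: (thread_cell_eq (k := m)); [exact: dm..|].
by rewrite !d_ (Xt _ _ (parallel_map r fg)).
Qed.

End Expansion.

(** * Groupoids free on a scheme *)

Section ThreadMap.
Variables (X Y : infty_groupoid) (f : infty_functor X Y).

Lemma thread_map_subproof (u : thread X) : threadP (fun k => f k (level u k)).
Proof. by move=> k; rewrite -gfun_src level_src. Qed.

Definition thread_map (u : thread X) : thread Y := exist _ _ (thread_map_subproof u).

Lemma level_map u k : level (thread_map u) k = f k (level u k).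
Proof. by []. Qed.

Lemma thread_map_bd b j u : thread_map (thread_bd b j u) = thread_bd b j (thread_map u).
Proof.
apply: (thread_eq (j := j)) => [k jk|k|]; last 1 first.
- case: b; last by rewrite level_map !level_bd_src.
  by rewrite level_map !level_bd_tgt gfun_tgt.
- by rewrite !level_map level_bd_gt // ifun_id.
exact: level_bd_gt.
Qed.

Lemma thread_map_cell j u : thread_bd false j u = u ->
  thread_bd false j (thread_map u) = thread_map u.
Proof. by rewrite -thread_map_bd => ->. Qed.

End ThreadMap.

Lemma thread_map_comp (X Y Z : infty_groupoid) (g : infty_functor Y Z)
    (f : infty_functor X Y) u :
  thread_map (infty_functor_comp g f) u = thread_map g (thread_map f u).
Proof. exact: thread_ext. Qed.

Section Schemes.

(** A scheme is a table of dimensions given by functions on natural numbers,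
    [up l] for l <= k and [lo l] for l < k being i_(l+1) and i'_(l+1). This makes
    it easy to alter the last entries of a table. *)
Definition valid_scheme k (up lo : nat -> nat) : Prop :=
  forall l, l < k -> lo l < up l /\ lo l < up l.+1.

(** A cocone in Y under the zigzag of disks, each disk D_(up l) -> Y being given
    by the thread of the corresponding cell. *)
Definition config (Y : infty_groupoid) k (up lo : nat -> nat) (a : nat -> thread Y) : Prop :=
  (forall l, l <= k -> thread_bd false (up l) (a l) = a l) /\
  (forall l, l < k -> thread_bd false (lo l) (a l) = thread_bd true (lo l) (a l.+1)).

Definition free_on (X : infty_groupoid) k up lo (a : nat -> thread X) : Prop :=
  config k up lo a /\
  forall (Y : infty_groupoid) (b : nat -> thread Y), config k up lo b ->
    (exists f : infty_functor X Y, forall l, l <= k -> thread_map f (a l) = b l) /\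
    forall f f' : infty_functor X Y,
      (forall l, l <= k -> thread_map f (a l) = b l) ->
      (forall l, l <= k -> thread_map f' (a l) = b l) -> f = f'.

Lemma config_map (X Y : infty_groupoid) (f : infty_functor X Y) k up lo a :
  config k up lo a -> config k up lo (fun l => thread_map f (a l)).
Proof.
by move=> [ac ag]; split=> l lk; rewrite -!thread_map_bd ?ac ?ag.
Qed.

Lemma free_on_ext (X Y : infty_groupoid) (f f' : infty_functor X Y) k up lo a :
  free_on k up lo a ->
  (forall l, l <= k -> thread_map f (a l) = thread_map f' (a l)) -> f = f'.
Proof.
by move=> [ac aU] ff'; apply: (aU _ _ (config_map f' ac)).2.
Qed.

(** Adding one cell to a scheme. Here X' is free on a scheme whose last disk has
    dimension m+1, and X is X' without the interior and the source of that disk: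
    either the last disk is lowered by one dimension, keeping its target x, or
    the last disk is glued to the previous ones along its whole target, and x is
    the cell of the previous disk to which it is glued. *)

Section Step.
Variables (X X' : infty_groupoid) (i : infty_functor X X').
Variables (k m : nat) (up lo : nat -> nat) (a' : nat -> thread X) (a : nat -> thread X').
Variable x : thread X.
Hypotheses (aF : free_on k up lo a) (upk : up k = m.+1).
Hypothesis ia : forall l, l < k -> thread_map i (a' l) = a l.
Hypothesis ix : thread_map i x = thread_bd true m (a k).
Hypothesis xm : thread_bd false m x = x.
Hypothesis a'c : forall l, l < k -> thread_bd false (up l) (a' l) = a' l.
Hypothesis a'g : forall l, l.+1 < k ->
  thread_bd false (lo l) (a' l) = thread_bd true (lo l) (a' l.+1).
Hypothesis a'x : forall l, l.+1 = k ->
  lo l <= m /\ thread_bd false (lo l) (a' l) = thread_bd true (lo l) x.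
Hypothesis a'_ext : forall (Y : infty_groupoid) (f f' : infty_functor X Y),
  (forall l, l < k -> thread_map f (a' l) = thread_map f' (a' l)) ->
  thread_map f x = thread_map f' x -> f = f'.

(** A morphism f out of X and a cell y with target f x assemble into a
    configuration of the scheme of X'. *)
Lemma step_freely_expands : freely_expands i (level x m) (level (a k) m.+1).
Proof.
move=> Y f y ty; pose z := to_thread y.
have z1 : thread_bd false m.+1 z = z by apply: to_thread_cell.
have tz : thread_bd true m z = thread_map f x.
  apply: (thread_cell_eq (k := m)).
  - exact: thread_bd_ge.
  - exact: thread_map_cell.
  by rewrite level_bd_tgt level_to_thread ty.
pose b l := if l < k then thread_map f (a' l) else z.
have bc : config k up lo b.
  split=> l lk; rewrite /b.
    case: ifP => [lk'|]; first by apply/thread_map_cell/a'c.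
    by rewrite ltn_neqAle lk andbT => /negbFE/eqP ->; rewrite upk.
  rewrite lk; case: ifP => [lk'|nlk]; first by rewrite -!thread_map_bd a'g.
  have [|lom E] := a'x (l := l); first by apply/eqP; rewrite eqn_leq lk leqNgt nlk.
  by rewrite -thread_map_bd E thread_map_bd -tz; apply: (@sbd_le (threads Y)).
have [ac aU] := aF.
have [[g gb] gU] := aU _ _ bc.
have bl l : l < k -> b l = thread_map f (a' l) by rewrite /b => ->.
have bk : b k = z by rewrite /b ltnn.
exists g; split.
- apply: a'_ext => [l lk|].
    by rewrite thread_map_comp ia // gb ?bl // ltnW.
  by rewrite thread_map_comp ix thread_map_bd gb // bk tz.
- by rewrite -level_map gb // bk level_to_thread.
move=> g' gi gz; apply: gU => // l; rewrite leq_eqVlt => /orP[/eqP ->|lk].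
  rewrite bk; apply: (thread_cell_eq (k := m.+1)) => //.
    by apply: thread_map_cell; rewrite -upk ac.1.
  by rewrite level_map gz level_to_thread.
by rewrite bl // -gi thread_map_comp ia.
Qed.

Lemma step_tgt : tgt (level (a k) m.+1) = i m (level x m).
Proof. by rewrite -level_bd_tgt -ix. Qed.

Lemma acyclic_step : acyclic X -> acyclic X'.
Proof. exact: (acyclic_expansion step_tgt step_freely_expands). Qed.

Lemma thin_step n : m < n -> thin X n -> thin X' n.
Proof. exact: (thin_expansion step_tgt step_freely_expands). Qed.

End Step.


Lemma unit_eq (x y : unit) : x = y.
Proof. by case: x y => -[]. Qed.

Definition unit_ssgpd : ssgpd.
Proof.
refine (@SSGpd unit (fun _ _ _ => tt) (fun _ _ _ => tt) _ _ _ _ _ _ _ _ _ _);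
  try by move=> *; apply: unit_eq.
by move=> i u _; exists tt; split; apply: unit_eq.
Defined.

Lemma unit_cell_eq n (x y : cells_of unit_ssgpd n) : x = y.
Proof. by apply: sval_inj; apply: unit_eq. Qed.

Definition point_mor (W : ssgpd) (x : W) (x0 : forall b j, sbd b j x = x) :
    ss_mor unit_ssgpd W :=
  @SSMor unit_ssgpd W (fun=> x) (fun b k _ => esym (x0 b k))
    (fun k _ _ _ => esym (scomp_diag (x0 false k))).

(** The identity of X factors through the terminal groupoid, because both
    endomorphisms of X fix the only generator. *)
Lemma free_point (X : infty_groupoid) up lo a :
  free_on (X := X) 0 up lo a -> up 0 = 0 ->
  forall n (y : X n), y = level (a 0) n.
Proof.
move=> aF up0 n y; have [[ac _] _] := aF.
have a0 : thread_bd false 0 (a 0) = a 0 by rewrite -{1}up0 ac.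
have aj b j : sbd b j (a 0 : threads X) = a 0.
  by apply: (@sbd_id (threads X) b j 0).
pose p := infty_functor_comp (from_threads X) (cells_map (point_mor aj)).
have cP k : @sbd unit_ssgpd false k tt = tt by [].
pose q : globular_map X (cells_of unit_ssgpd) :=
  @GlobularMap X (cells_of unit_ssgpd) (fun k _ => exist _ tt (cP k))
    (fun _ _ => unit_cell_eq _ _) (fun _ _ => unit_cell_eq _ _).
pose Q : infty_functor X (cells_of unit_ssgpd) :=
  @InftyFunctor X (cells_of unit_ssgpd) q
    (fun i j lt u v e e' => unit_cell_eq _ _) (fun _ _ => unit_cell_eq _ _).
have E : infty_functor_comp p Q = infty_functor_id X.
  apply: (free_on_ext aF) => l; rewrite leqn0 => /eqP ->.
  exact: thread_ext.
exact: esym (congr1 (fun h : infty_functor _ _ => h n y) E).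
Qed.

Hypothesis free_ex : forall k up lo, valid_scheme k up lo ->
  exists (X : infty_groupoid) (a : nat -> thread X), free_on k up lo a.

Definition acyclic_thin (X : infty_groupoid) k (up : nat -> nat) : Prop :=
  acyclic X /\ forall n, (forall l, l <= k -> up l <= n) -> thin X n.

(** Induction on the number of disks, then on the dimension m+1 of the last one.
    If the last disk is glued along a cell of dimension < m (or is the only one),
    it is lowered by one dimension; if it is glued along its whole m-dimensional
    target, it is removed. In both cases the free groupoid is a free expansion of
    that of the smaller scheme, along an m-cell. The base case is D_0. *)
Lemma free_acyclic_thin k up lo (X : infty_groupoid) (a : nat -> thread X) :
  valid_scheme k up lo -> free_on k up lo a -> acyclic_thin X k up.
Proof.
(* lowering the last disk by one dimension *)
have lower k' m up' lo' (Y : infty_groupoid) (b : nat -> thread Y) :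
    (forall up lo (X : infty_groupoid) (a : nat -> thread X),
      up k' = m -> valid_scheme k' up lo -> free_on k' up lo a -> acyclic_thin X k' up) ->
    (forall l, l.+1 = k' -> lo' l < m) ->
    up' k' = m.+1 -> valid_scheme k' up' lo' -> free_on k' up' lo' b -> acyclic_thin Y k' up'.
  move=> IH lom upk v bF; have [[bc bg] _] := bF.
  pose up2 l := if l < k' then up' l else m.
  have v2 : valid_scheme k' up2 lo'.
    move=> l lk; rewrite /up2 lk; have [v1 v2] := v l lk; split=> //.
    case: ifP => // nlk; apply: lom; apply/eqP.
    by rewrite eqn_leq lk leqNgt nlk.
  have [X0 [a' a'F]] := free_ex v2.
  have [[a'c a'g] a'U] := a'F.
  have uk : up2 k' = m by rewrite /up2 ltnn.
  have [Xa Xt] := IH _ _ _ _ uk v2 a'F.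
  pose b' l := if l < k' then b l else thread_bd true m (b k').
  have b'c : config k' up2 lo' b'.
    split=> l lk; rewrite /b' /up2.
      case: ifP => lk'; [exact: bc|exact: thread_bd_ge].
    rewrite lk; case: ifP => nlk; first exact: bg.
    have E : l.+1 = k' by apply/eqP; rewrite eqn_leq lk leqNgt nlk.
    rewrite bg // E; apply/esym; apply: thread_bd_lt; exact: lom.
  have [[i ib] _] := a'U _ _ b'c.
  (* the hypotheses of a step, x being the lowered last disk *)
  have hA l : l < k' -> thread_map i (a' l) = b l.
    by move=> lk; rewrite ib ?(ltnW lk) // /b' lk.
  have hB : thread_map i (a' k') = thread_bd true m (b k').
    by rewrite ib // /b' ltnn.
  have hC : thread_bd false m (a' k') = a' k' by rewrite -{1}uk a'c.
  have hD l : l < k' -> thread_bd false (up' l) (a' l) = a' l.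
    by move=> lk; have := a'c _ (ltnW lk); rewrite /up2 lk.
  have hE l : l.+1 < k' -> thread_bd false (lo' l) (a' l) = thread_bd true (lo' l) (a' l.+1).
    by move=> lk; apply/a'g/ltnW.
  have hF l : l.+1 = k' ->
      lo' l <= m /\ thread_bd false (lo' l) (a' l) = thread_bd true (lo' l) (a' k').
    move=> lk; split; first by apply/ltnW/lom.
    by rewrite a'g -lk.
  have hG (Z : infty_groupoid) (f f' : infty_functor X0 Z) :
    (forall l, l < k' -> thread_map f (a' l) = thread_map f' (a' l)) ->
    thread_map f (a' k') = thread_map f' (a' k') -> f = f'.
    move=> fl fk; apply: (free_on_ext a'F) => l.
    by rewrite leq_eqVlt => /orP[/eqP ->|/fl].
  split; first exact: (acyclic_step bF upk hA hB hC hD hE hF hG).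
  move=> n un; have mn : m < n by rewrite -upk un.
  apply: (thin_step bF upk hA hB hC hD hE hF hG mn); apply: Xt => l lk.
  by rewrite /up2; case: ifP => _; [apply: un|apply: ltnW].
elim: k up lo X a => [|k IHk] up lo X a.
  have [m Em] : exists m, up 0 = m by exists (up 0).
  elim: m up lo X a Em => [|m IHm] up lo X a up0 v aF; last first.
    exact: (lower _ _ _ _ _ _ IHm _ up0 v aF).
  have E := free_point aF up0.
  split=> [n f g _|n _ f g _]; last by rewrite (E _ f) (E _ g).
  by exists (level (a 0) n.+1); split; exact: etrans (E _ _) (esym (E _ _)).
have [m Em] : exists m, up k.+1 = m by exists (up k.+1).
elim: m up lo X a Em => [|m IHm] up lo X a upk v aF.
  by have [_] := v k (ltnSn k); rewrite upk.
have [lt|] := ltnP (lo k) m.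
  by apply: (lower _ _ _ _ _ _ IHm _ upk v aF) => l [->].
have [_] := v k (ltnSn k); rewrite upk ltnS => le1 le2.
have lok : lo k = m by apply/eqP; rewrite eqn_leq le1.
have [[ac ag] _] := aF.
have v2 : valid_scheme k up lo by move=> l lk; apply/v/ltnW.
have [X0 [a' a'F]] := free_ex v2.
have [[a'c a'g] a'U] := a'F.
have [Xa Xt] := IHk _ _ _ _ v2 a'F.
have c2 : config k up lo a by split=> l lk; [apply/ac/ltnW|apply/ag/ltnW].
have [[i ia] _] := a'U _ _ c2.
(* the hypotheses of a step, x being the cell to which the last disk is glued *)
have hA l : l < k.+1 -> thread_map i (a' l) = a l by apply: ia.
have hB : thread_map i (thread_bd false m (a' k)) = thread_bd true m (a k.+1).
  by rewrite thread_map_bd ia // -lok ag.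
have hC : thread_bd false m (thread_bd false m (a' k)) = thread_bd false m (a' k).
  exact: thread_bd_ge.
have hD l : l < k.+1 -> thread_bd false (up l) (a' l) = a' l by apply: a'c.
have hE l : l.+1 < k.+1 -> thread_bd false (lo l) (a' l) = thread_bd true (lo l) (a' l.+1).
  by apply: a'g.
have hF l : l.+1 = k.+1 -> lo l <= m /\ thread_bd false (lo l) (a' l)
    = thread_bd true (lo l) (thread_bd false m (a' k)).
  by move=> [->]; rewrite lok leqnn thread_bd_ge.
have hG (Z : infty_groupoid) (f f' : infty_functor X0 Z) :
    (forall l, l < k.+1 -> thread_map f (a' l) = thread_map f' (a' l)) ->
    thread_map f (thread_bd false m (a' k)) = thread_map f' (thread_bd false m (a' k)) ->
    f = f'.
  by move=> fl _; apply: (free_on_ext a'F).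
split; first exact: (acyclic_step aF upk hA hB hC hD hE hF hG).
move=> n un; have mn : m < n by rewrite -upk un.
apply: (thin_step aF upk hA hB hC hD hE hF hG mn); apply: Xt => l lk.
exact/un/ltnW.
Qed.

End Schemes.

(** * Globular sums of disks *)

Definition disk_top n : disk n n := exist _ None (eqxx n).

(** Yoneda: every cell of D_n is an iterated boundary of the top cell. *)
Lemma disk_map_ext n (Y : globular_set) (f g : globular_map (disk n) Y) :
  f n (disk_top n) = g n (disk_top n) -> f = g.
Proof.
move=> fg; apply: globular_map_ext => j c.
have jn : j <= n by case: c => -[b|] /= => [/ltnW|/eqP ->].
have [d nE] := leq_addE jn.
elim: d j c jn nE => [|d IH] j c jn nE.
  have cE : sval c = None by case: c => -[b|] //=; rewrite nE ltnn.
  have {}nE : n = j by [].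
  by subst j; have -> : c = disk_top n by apply: disk_cell_inj.
have jn' : j < n by rewrite nE ltnS leq_addl.
have [c'] : exists c' : disk_cell n j.+1, True.
  have [E|ne] := eqVneq j.+1 n; first by exists (exist _ None (introT eqP E)).
  have lt : j.+1 < n by rewrite ltn_neqAle ne.
  by exists (exist _ (Some false) lt).
move=> _; have [b cE] : exists b, sval c = Some b.
  by case: c => -[b|] /=; [exists b|move=> /eqP E; rewrite E ltnn in jn'].
have -> : c = disk_bdry b c' by apply: disk_cell_inj.
have E : f j.+1 c' = g j.+1 c' by apply: IH => //; rewrite nE addnS.
case: b {cE}.
  by have := gfun_tgt f c'; have := gfun_tgt g c'; rewrite /= => -> ->; rewrite E.
by have := gfun_src f c'; have := gfun_src g c'; rewrite /= => -> ->; rewrite E.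
Qed.

Section DiskMaps.
Variable Y : infty_groupoid.

Program Definition disk_map n (u : thread Y) : globular_map (disk n) Y :=
  @GlobularMap (disk n) Y (fun j c => match sval c with
     Some true => tgt (level u j.+1) | _ => level u j end) _ _.
Next Obligation.
by case: x => -[[]|] /= _; rewrite ?src_tgt !level_src.
Qed.
Next Obligation.
by case: x => -[[]|] //= _; rewrite -tgt_src level_src.
Qed.

Lemma disk_map_top n u : disk_map n u n (disk_top n) = level u n.
Proof. by []. Qed.

End DiskMaps.

Lemma sval_disk_ecast (j m n : nat) (e : m = n) (f : hom (disk j : gset) (disk m)) l c :
  sval ((ecast k (hom (disk j : gset) (disk k)) e f : globular_map _ _) l c)
  = sval ((f : globular_map _ _) l c).
Proof. by case: n / e. Qed.

Lemma gsigma_iter_top i j (le : j <= i) : j < i ->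
  sval ((gsigma_iter gset le : globular_map _ _) j (disk_top j)) = Some false.
Proof.
rewrite /gsigma_iter sval_disk_ecast -subn_gt0; case: (i - j) => // d _ /=.
by elim: d => //= d ->.
Qed.

Lemma gtau_iter_top i j (le : j <= i) : j < i ->
  sval ((gtau_iter gset le : globular_map _ _) j (disk_top j)) = Some true.
Proof.
rewrite /gtau_iter sval_disk_ecast -subn_gt0; case: (i - j) => // d _ /=.
by elim: d => //= d ->.
Qed.

Lemma disk_map_sigma (Y : infty_groupoid) (u : thread Y) i j (le : j <= i) : j < i ->
  ((disk_map i u : hom (disk i : gset) Y) ∘ gsigma_iter gset le : globular_map _ _)
    j (disk_top j) = level u j.
Proof. by move=> ji; rewrite /= gsigma_iter_top. Qed.

Lemma disk_map_tau (Y : infty_groupoid) (u : thread Y) i j (le : j <= i) : j < i ->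
  ((disk_map i u : hom (disk i : gset) Y) ∘ gtau_iter gset le : globular_map _ _)
    j (disk_top j) = tgt (level u j.+1).
Proof. by move=> ji; rewrite /= gtau_iter_top. Qed.

Section FreeOnTable.
Variable L : left_adjoint forgetful.
Variables (k : nat) (up lo : nat -> nat) (v : valid_scheme k up lo).

Lemma ltl_subproof (l : 'I_k) : lo l < up (lidx l).
Proof. by have [] := v (ltn_ord l). Qed.

Lemma ltr_subproof (l : 'I_k) : lo l < up (ridx l).
Proof. by have [] := v (ltn_ord l). Qed.

Definition scheme_table : table :=
  @Table k (fun l => up l) (fun l => lo l) ltl_subproof ltr_subproof.

Let T := scheme_table.
Let X : infty_groupoid := L (gsum T).

Definition leg_map (Y : globular_set) (f : hom (gsum T : gset) Y) (l : 'I_k.+1) :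
  globular_map (disk (up l)) Y := f ∘ leg (gsum_cocone T) l.

Definition scheme_cells (l : nat) : thread X :=
  to_thread (leg_map (ladj_unit L (gsum T)) (inord l) _ (disk_top (up (inord l : 'I_k.+1)))).

Lemma scheme_cells_bd (l : 'I_k.+1) :
  thread_bd false (up l) (scheme_cells l) = scheme_cells l.
Proof. by rewrite /scheme_cells inord_val; apply: to_thread_cell. Qed.

Lemma disk_map_scheme_cells (l : 'I_k.+1) :
  disk_map (up l) (scheme_cells l) = leg_map (ladj_unit L (gsum T)) l.
Proof.
apply: disk_map_ext; rewrite disk_map_top /scheme_cells inord_val.
by rewrite level_to_thread.
Qed.

(** Both sides are determined by their value at the top cell of D_(lo l), where
    they are the iterated source of u and the iterated target of w. *)
Lemma glue_config (Y : infty_groupoid) (u w : thread Y) (l : 'I_k) :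
  thread_bd false (lo l) u = thread_bd true (lo l) w <->
  (disk_map (up (lidx l)) u : hom (disk (up (lidx l)) : gset) Y)
     ∘ gsigma_iter gset (ltnW (ltl_subproof l))
  = (disk_map (up (ridx l)) w : hom (disk (up (ridx l)) : gset) Y)
     ∘ gtau_iter gset (ltnW (ltr_subproof l)).
Proof.
rewrite thread_composableP; split=> [E|E].
  apply: disk_map_ext.
  rewrite (disk_map_sigma _ _ (ltl_subproof l)).
  by rewrite (disk_map_tau _ _ (ltr_subproof l)).
rewrite -(disk_map_sigma u (ltnW (ltl_subproof l)) (ltl_subproof l)).
by rewrite -(disk_map_tau w (ltnW (ltr_subproof l)) (ltr_subproof l)) E.
Qed.

(** Morphisms out of L(G_T) are maps out of G_T, that is cocones under the zigzag,
    that is configurations. *)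
Lemma scheme_cells_free : free_on k up lo scheme_cells.
Proof.
split.
  split=> l lk; first exact: scheme_cells_bd (Ordinal (lk : l < k.+1)).
  have := glue_config (scheme_cells l) (scheme_cells l.+1) (Ordinal lk).
  case=> _; apply.
  have := leg_glue (gsum_cocone T) (Ordinal lk).
  move/(congr1 (fun h : hom (disk _ : gset) _ =>
    (ladj_unit L (gsum T) : hom (gsum T : gset) _) ∘ h)).
  rewrite !compcA.
  have := disk_map_scheme_cells (lidx (Ordinal lk)).
  have := disk_map_scheme_cells (ridx (Ordinal lk)).
  rewrite /leg_map => E1 E2.
  by move=> E; rewrite [X in X ∘ _]E2 [X in _ = X ∘ _]E1.
move=> Y b [bc bg]; split.
  have glue (l : 'I_k) := (glue_config (b l) (b l.+1) l).1 (bg l (ltn_ord l)).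
  pose c := @Cocone gset T Y (fun l => disk_map (up l) (b l)) glue.
  exists (ladj_ext L (gsum_desc c : hom (gsum T : gset) (forgetful Y))) => l lk.
  pose o : 'I_k.+1 := Ordinal (lk : l < k.+1).
  apply: (thread_cell_eq (k := up l)).
  - exact: thread_map_cell (scheme_cells_bd o).
  - exact: bc.
  rewrite level_map -(disk_map_top (up o) (scheme_cells o)) disk_map_scheme_cells.
  have E := ladj_ext_unit L (gsum_desc c : hom (gsum T : gset) (forgetful Y)).
  have E' := congr1 (fun h => h ∘ leg (gsum_cocone T) o) E.
  rewrite gsum_descE in E'.
  exact: (congr1 (fun h : globular_map _ _ => h _ (disk_top (up l))) E').
move=> f f' fb f'b; apply: (@ladj_hom_ext _ _ _ L); apply: gsum_hom_ext => l.
apply: disk_map_ext.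
have E g : (forall l, l <= k -> thread_map g (scheme_cells l) = b l) ->
    ((fmap forgetful (g : hom (L (gsum T)) Y) ∘ ladj_unit L (gsum T))
      ∘ leg (gsum_cocone T) l : globular_map _ _) (up l) (disk_top (up l))
    = level (b l) (up l).
  move=> gb; rewrite -gb -1?ltnS // level_map -disk_map_top.
  by rewrite disk_map_scheme_cells.
exact: etrans (E _ fb) (esym (E _ f'b)).
Qed.

End FreeOnTable.

Lemma free_on_ex (L : left_adjoint forgetful) k up lo : valid_scheme k up lo ->
  exists (X : infty_groupoid) (a : nat -> thread X), free_on k up lo a.
Proof.
move=> v; exists (L (gsum (scheme_table v))), (scheme_cells L v).
exact: scheme_cells_free.
Qed.

Lemma table_scheme (T : table) : exists k up lo (v : valid_scheme k up lo),
  T = scheme_table v.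
Proof.
case: T => k up lo ltl ltr.
pose up' l := up (inord l : 'I_k.+1).
pose lo' l := if insub l is Some o then lo (o : 'I_k) else 0.
have loE (l : 'I_k) : lo' l = lo l by rewrite /lo' valK.
have upE (l : 'I_k.+1) : up' l = up l by rewrite /up' inord_val.
have v : valid_scheme k up' lo'.
  move=> l lk; pose o := Ordinal lk.
  rewrite -[l]/(val o) loE; split; first by rewrite -[val o]/(val (lidx o)) upE.
  by rewrite -[(val o).+1]/(val (ridx o)) upE.
exists k, up', lo', v; rewrite /scheme_table.
have Eu : up = (fun l => up' l) by apply: functional_extensionality_dep => l.
have El : lo = (fun l => lo' l) by apply: functional_extensionality_dep => l.
move: (ltl_subproof v) (ltr_subproof v).
move: ltl ltr; rewrite {1 2 3}Eu El => *.
congr Table; exact: Prop_irrelevance.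
Qed.

Lemma acyclic_gsum (L : left_adjoint forgetful) (T : table) : acyclic (L (gsum T)).
Proof.
have [k [up [lo [v ->]]]] := table_scheme T.
exact: (free_acyclic_thin (free_on_ex L) v (scheme_cells_free L v)).1.
Qed.

Lemma thin_gsum (L : left_adjoint forgetful) (T : table) n :
  tdim T <= n -> thin (L (gsum T)) n.
Proof.
have [k [up [lo [v ->]]]] := table_scheme T.
move=> Tn; apply: (free_acyclic_thin (free_on_ex L) v (scheme_cells_free L v)).2 => l lk.
apply: leq_trans Tn; rewrite leq_max; apply/orP; left.
exact: (leq_bigmax (Ordinal (lk : l < k.+1))).
Qed.

(** * Liftings in Theta tilde *)

(** Two colimits of the same diagram are isomorphic; one half of that suffices
    below. *)
Lemma colimit_section (C : category_under_globe) T (X Y : C) (c : cocone T X)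
    (d : cocone T Y) :
  is_colimit c -> is_colimit d ->
  exists (h : hom X Y) (k : hom Y X), k ∘ h = idc X.
Proof.
move=> cU dU; have [h [hE _]] := cU _ d; have [k [kE _]] := dU _ c.
exists h, k; have [i [_ iU]] := cU _ c.
rewrite -(iU (k ∘ h)) => [|l]; first by apply: iU => l; rewrite comp1c.
by rewrite -compcA hE kE.
Qed.

Section Lifting.
Variables (L : left_adjoint forgetful) (S : table).

(** By adjunction and Yoneda, a morphism D_n -> S of Theta tilde is an n-cell of
    L(G_S). *)
Definition hom_cell n (f : hom (gD n : theta_tilde L) S) : L (gsum S) n :=
  (theta_cell f : globular_map _ _) n (disk_top n).

Lemma hom_cell_inj n : injective (@hom_cell n).
Proof. by move=> f g fg; apply: theta_cell_inj; apply: disk_map_ext. Qed.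

Lemma hom_cell_surj n (y : L (gsum S) n) : exists f, @hom_cell n f = y.
Proof.
pose u : hom (disk n : gset) (forgetful (L (gsum S))) := disk_map n (to_thread y).
exists (ladj_ext L (gsum_tdisk_desc u)).
by rewrite /hom_cell /theta_cell ladj_ext_unit gsum_tdisk_descE /= level_to_thread.
Qed.

Lemma disk_incl_top n b :
  disk_incl n b n (disk_top n) = disk_bdry b (disk_top n.+1).
Proof. exact: disk_cell_inj. Qed.

Lemma hom_cell_src n (h : hom (gD n.+1 : theta_tilde L) S) :
  hom_cell (h ∘ gsigma n) = src (hom_cell h).
Proof.
rewrite /hom_cell [theta_cell _](theta_cell_map (gsigma (c := gset) n) h).
apply: etrans (gfun_src (theta_cell h : globular_map _ _) (disk_top n.+1)).
exact: (congr1 ((theta_cell h : globular_map _ _) n) (disk_incl_top n false)).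
Qed.

Lemma hom_cell_tgt n (h : hom (gD n.+1 : theta_tilde L) S) :
  hom_cell (h ∘ gtau n) = tgt (hom_cell h).
Proof.
rewrite /hom_cell [theta_cell _](theta_cell_map (gtau (c := gset) n) h).
apply: etrans (gfun_tgt (theta_cell h : globular_map _ _) (disk_top n.+1)).
exact: (congr1 ((theta_cell h : globular_map _ _) n) (disk_incl_top n true)).
Qed.

Lemma globularly_parallelP n (f g : hom (gD n : theta_tilde L) S) :
  globularly_parallel f g <-> parallel (hom_cell f) (hom_cell g).
Proof.
case: n f g => // n f g /=; rewrite -!hom_cell_src -!hom_cell_tgt.
split=> -[s t]; split; [exact: (congr1 (@hom_cell n) s)
  | exact: (congr1 (@hom_cell n) t) | exact: hom_cell_inj s | exact: hom_cell_inj t].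
Qed.

Lemma is_liftingP n (f g : hom (gD n : theta_tilde L) S) h :
  is_lifting f g h <-> src (hom_cell h) = hom_cell f /\ tgt (hom_cell h) = hom_cell g.
Proof.
rewrite -!hom_cell_src -!hom_cell_tgt.
split=> -[s t]; split; [exact: (congr1 (@hom_cell n) s)
  | exact: (congr1 (@hom_cell n) t) | exact: hom_cell_inj s | exact: hom_cell_inj t].
Qed.

End Lifting.

Theorem theorem6p2 (L : left_adjoint forgetful) :
  canonically_contractible (theta_tilde L).
Proof.
move=> n S f g [/globularly_parallelP fg [T [c cU] Tn]].
have St : thin (L (gsum S)) n.+1.
  have [h [k kh]] := colimit_section cU (@theta_colimit L T).
  have khE (x : L (gsum S) n.+1) : (k : infty_functor _ _) _ ((h : infty_functor _ _) _ x) = x.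
    exact: (congr1 (fun h : infty_functor _ _ => h n.+1 x) kh).
  move=> x y xy; rewrite -(khE x) -(khE y).
  by rewrite (thin_gsum Tn (parallel_map (h : infty_functor _ _) xy)).
have [y [sy ty]] := acyclic_gsum fg; have [h hy] := hom_cell_surj y.
exists h; split; first by apply/is_liftingP; rewrite hy.
move=> h' /is_liftingP[sh' th']; apply: hom_cell_inj; rewrite hy.
by apply: St; rewrite /= sy ty sh' th'.
Qed.
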